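(* For any $n$-node unweighted undirected input graph $G$, there is a randomized algorithm that runs in $\widetilde{O}(n^{3/2})$ time and with high probability computes an adjacency oracle for a $5$-spanner $H$ of $G$ with $|E(H)|=\widetilde{O}(n^{4/3})$.
   Context: A $t$-spanner of $G$ is an edge-subgraph $H$ with $\mathrm{dist}_H(s,t')\le t\cdot\mathrm{dist}_G(s,t')$ for all vertices $s,t'$. The input graph $G$ is given both as an adjacency list (degree, neighbor list and uniformly random neighbor available in $\widetilde{O}(1)$ time per access) and as an adjacency matrix/oracle (edge membership testable in $\widetilde{O}(1)$ time). An adjacency oracle for $H$ is a data structure that, on query $(u,v)$, deterministically returns in $\widetilde{O}(1)$ time a bit indicating whether $(u,v)\in E(H)$; $H$ is fixed at the end of construction. Running time means construction time. $\widetilde{O}$ hides $\mathrm{polylog}(n)$ factors; ''with high probability'' means probability at least $1-1/n^{c}$ for an absolute constant $c>0$. *)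

(* Defs.v *)
From HB Require Import structures.
From mathcomp Require Import all_boot all_order all_algebra.
From mathcomp Require Import all_classical all_reals all_analysis.
Set Implicit Arguments.
Unset Strict Implicit.
Unset Printing Implicit Defensive.
Import Order.TTheory GRing.Theory Num.Theory.
Local Open Scope classical_set_scope.
Local Open Scope ring_scope.

Record graph (n : nat) := Graph {
  adj :> rel 'I_n;
  adj_sym : symmetric adj;
  adj_irr : irreflexive adj }.

Definition edges (n : nat) (G : graph n) : {set {set 'I_n}} :=
  [set [set x.1; x.2]%SET | x in [set x : 'I_n * 'I_n | G x.1 x.2]%SET]%SET.

(* [p] lists the vertices after [u], so [size p] is the number of edges of the
   walk; the distance is +oo when no walk exists. *)
Definition dist (R : realType) (n : nat) (G : graph n) (u v : 'I_n) : \bar R :=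
  ereal_inf [set (size p)%:R%:E | p in [set p | path G u p /\ last u p = v]].

Definition spanner (R : realType) (t : nat) (n : nat) (G H : graph n) : Prop :=
  subrel H G /\
  forall u v : 'I_n, (dist R H u v <= t%:R%:E * dist R G u v)%E.

(* The adjacency-list order is arbitrary and belongs to the input. *)
Record input (n : nat) := Input {
  input_graph :> graph n;
  nbrs : 'I_n -> seq 'I_n;
  nbrs_uniq : forall u, uniq (nbrs u);
  nbrsE : forall u v, (v \in nbrs u) = input_graph u v }.

(* Accesses by vertex number; numbers >= n denote isolated vertices. *)
Definition nbr_list (n : nat) (G : input n) (u : nat) : seq nat :=
  if insub u is Some i then [seq val j | j <- nbrs G i] else [::].

Definition adj_test (n : nat) (G : input n) (u v : nat) : bool :=
  if (insub u, insub v) is (Some i, Some j) then input_graph G i j else false.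

(* A randomized word RAM, programmed in a while language.  Programs are finite
   and do not depend on n; hence an expression is a constant number of word
   operations and the evaluations in one command are charged a single time
   unit.  Sub is truncated, Lt and Eq return 0 or 1. *)

Variant binop := Add | Sub | Mul | Div | Mod | Lt | Eq.

Inductive expr :=
  | Cst of nat
  | Reg of nat
  | Mem of expr
  | Bop of binop & expr & expr.

Inductive cmd :=
  | Skip
  | Assign of nat & expr           (* register := value *)
  | Store of expr & expr           (* memory[address] := value *)
  | Rand of nat & expr             (* register := uniform in [0, value) *)
  | Degree of nat & expr           (* register := degree of vertex *)
  | Neighbor of nat & expr & expr  (* register := i-th neighbor of vertex *)
  | RandNeighbor of nat & expr     (* register := uniform neighbor of vertex *)
  | Adjacent of nat & expr & expr  (* register := adjacency bit *)
  | Seq of cmd & cmd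
  | If of expr & cmd & cmd
  | While of expr & cmd.

Fixpoint deterministic (c : cmd) : bool :=
  match c with
  | Rand _ _ | RandNeighbor _ _ => false
  | Seq c1 c2 | If _ c1 c2 => deterministic c1 && deterministic c2
  | While _ c1 => deterministic c1
  | _ => true
  end.

Record state := State { reg : nat -> nat; ram : nat -> nat }.

Definition upd (f : nat -> nat) (i x : nat) : nat -> nat :=
  fun j => if j == i then x else f j.

Definition set_reg (s : state) (r x : nat) : state :=
  State (upd (reg s) r x) (ram s).

Definition set_mem (s : state) (a x : nat) : state :=
  State (reg s) (upd (ram s) a x).

Definition binop_sem (o : binop) (x y : nat) : nat :=
  match o with
  | Add => (x + y)%N
  | Sub => (x - y)%N
  | Mul => (x * y)%N
  | Div => (x %/ y)%N
  | Mod => (x %% y)%N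
  | Lt => (x < y)%N
  | Eq => x == y
  end.

(* Arithmetic on [w]-bit words. *)
Fixpoint eval (w : nat) (s : state) (e : expr) : nat :=
  match e with
  | Cst x => (x %% 2 ^ w)%N
  | Reg r => reg s r
  | Mem e1 => ram s (eval w s e1)
  | Bop o e1 e2 => (binop_sem o (eval w s e1) (eval w s e2) %% 2 ^ w)%N
  end.

(* Commands still to be executed, and the current state. *)
Definition config : Type := (seq cmd * state)%type.

(* [Step cost f]: at the given cost, move to [f i] for [i] uniform in 'I_k.+1. *)
Variant transition :=
  | Halted
  | Step (cost k : nat) of ('I_k.+1 -> config).

Definition det_step (cost : nat) (cf : config) : transition :=
  @Step cost 0 (fun=> cf).

(* [w] is the word size and [a] the time of one access to the input graph.
   Drawing from an empty range, or from an empty neighbor list, gives 0. *)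
Definition step (w a n : nat) (G : input n) (cf : config) : transition :=
  let s := cf.2 in
  let ev := eval w s in
  match cf.1 with
  | [::] => Halted
  | c :: cs =>
    match c with
    | Skip => det_step 1 (cs, s)
    | Assign r e => det_step 1 (cs, set_reg s r (ev e))
    | Store e1 e2 => det_step 1 (cs, set_mem s (ev e1) (ev e2))
    | Rand r e =>
        @Step 1 (ev e).-1 (fun i => (cs, set_reg s r (nat_of_ord i)))
    | Degree r e => det_step a (cs, set_reg s r (size (nbr_list G (ev e))))
    | Neighbor r e1 e2 =>
        det_step a (cs, set_reg s r (nth 0%N (nbr_list G (ev e1)) (ev e2)))
    | RandNeighbor r e =>
        let l := nbr_list G (ev e) in
        @Step a (size l).-1 (fun i => (cs, set_reg s r (nth 0%N l i)))
    | Adjacent r e1 e2 =>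
        det_step a (cs, set_reg s r (adj_test G (ev e1) (ev e2)))
    | Seq c1 c2 => det_step 1 (c1 :: c2 :: cs, s)
    | If e c1 c2 => det_step 1 ((if ev e != 0%N then c1 else c2) :: cs, s)
    | While e c1 =>
        det_step 1 (if ev e != 0%N then c1 :: While e c1 :: cs else cs, s)
    end
  end.

(* Whatever the random choices, the run from the given configuration halts
   after total cost at most [t], in a state satisfying [Q]. *)
Inductive halts_within (w a n : nat) (G : input n) (Q : state -> Prop) :
    nat -> config -> Prop :=
  | halts_now t cf :
      step w a G cf = Halted -> Q cf.2 -> halts_within w a G Q t cf
  | halts_step t cf cost k (f : 'I_k.+1 -> config) :
      step w a G cf = Step cost f -> (cost <= t)%N ->
      (forall i, halts_within w a G Q (t - cost) (f i)) ->
      halts_within w a G Q t cf.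

(* Probability of halting in at most [m] transitions in a state satisfying
   [E]. *)
Fixpoint prob_upto (R : realType) (w a n : nat) (G : input n)
    (E : state -> Prop) (m : nat) (cf : config) : R :=
  match step w a G cf with
  | Halted => `[< E cf.2 >]%:R
  | @Step _ k f =>
      if m is m'.+1 then
        (\sum_(i < k.+1) prob_upto R w a G E m' (f i)) / k.+1%:R
      else 0
  end.

Definition prob (R : realType) (w a n : nat) (G : input n)
    (E : state -> Prop) (cf : config) : R :=
  sup (range (fun m => prob_upto R w a G E m cf)).

(* Words of Theta(log n) bits; n itself always fits in a word. *)
Definition word_size (b n : nat) : nat := (b.+1 * (trunc_log 2 n).+1)%N.

Definition zeros : nat -> nat := fun=> 0%N.

(* The construction starts on a blank memory, with n in register 0. *)
Definition build_start (n : nat) (build : cmd) : config :=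
  ([:: build], State (upd zeros 0 n) zeros).

(* A query starts on the memory [M] left by the construction, with n, u, v in
   registers 0, 1, 2.  Like the construction it may access the input graph. *)
Definition query_start (n : nat) (M : nat -> nat) (query : cmd) (u v : 'I_n) :
    config :=
  ([:: query], State (upd (upd (upd zeros 0 n) 1 u) 2 v) M).

(* With contents [M], queries return in register 0, within time [q], the
   adjacency bit of [H]. *)
Definition adjacency_oracle (w a n : nat) (G : input n) (M : nat -> nat)
    (query : cmd) (q : nat) (H : graph n) : Prop :=
  deterministic query /\
  forall u v : 'I_n,
    halts_within w a G (fun s => reg s 0%N = H u v :> nat) q
      (query_start M query u v).

(* f = O~(g), with polylogarithmic factor (ln n)^k *)
Definition softO (R : realType) (f g : nat -> R) : Prop :=
  exists (C : R) (k : nat),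
    \forall n \near \oo, `|f n| <= C * `|g n| * ln n%:R ^+ k.

(* Main.v *)
Require Import Defs.
From HB Require Import structures.
From mathcomp Require Import all_boot all_order all_algebra.
From mathcomp Require Import all_classical all_reals all_analysis.
From mathcomp Require Import zify ring.
Import Defs.
Set Implicit Arguments.
Unset Strict Implicit.
Unset Printing Implicit Defensive.
Import Order.TTheory GRing.Theory Num.Theory.
Local Open Scope classical_set_scope.
Local Open Scope ring_scope.

(** With q = n^(1/2), r = n^(1/3) (rounded up) and L = Theta(log n), draw
    M = r^2 L uniform vertices, the centers, numbered from 1 to M.  The cluster
    c(v) of v is the largest number of a center adjacent to v; vertices of
    degree < q find it by scanning their neighbors, the others by testing the
    last T = q L centers.  Then every vertex u draws T random neighbors x, and
    records the edge ux for the pair (c(u), c(x)).  An edge uv of G is dropped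
    from H only if both ends have a cluster, neither end is the center of the
    other, and the pair (c(u), c(v)) has a recorded edge xy different from uv;
    H then contains the path from u to its center, x, y, the center of v, and v.
    So H is always a 5-spanner, whatever the random choices.

    Its size is controlled with high probability.  Every v satisfies
    deg(v) (M - c(v)) <= L n, since otherwise the last M - c(v) centers all
    missed the neighborhood of v; hence a vertex without cluster has degree at
    most r.  Moreover u with c(u) = i has degree O(L n / (M - i + 1)), so a pair
    (i, j) joined by e edges stays unrecorded with probability at most
    exp (- T e (M - i + 1) / (2 L n)).  Hence the unrecorded pairs contribute
    O(M sum_i L q / (M - i + 1)) = O~(n^(7/6)) edges, and the recorded ones at
    most (M + 1)^2 = O~(n^(4/3)).

    The two probability estimates are run through the program as potentials:
    a triple bounds the running time and the expectation of a function of the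
    final state. *)

(** * Soundness of runs annotated with error bounds *)

(** A halting tree whose nodes carry bounds: [g] bounds the expected [Bad] after each outcome, and
    [e] only has to dominate the average of [g]. The time bound [t] holds on every branch. *)
Inductive run (R : realType) (w a n : nat) (G : input n) (Qf : state -> Prop)
    (Bad : state -> R) : nat -> R -> config -> Prop :=
  | run_halt t e s : Qf s -> Bad s <= e -> run w a G Qf Bad t e ([::], s)
  | run_step t e cf cost k (f : 'I_k.+1 -> config) (g : 'I_k.+1 -> R) :
      step w a G cf = Step cost f -> (cost <= t)%N ->
      (\sum_i g i) / k.+1%:R <= e ->
      (forall i, run w a G Qf Bad (t - cost) (g i) (f i)) ->
      run w a G Qf Bad t e cf.

Section Soundness.
Variables (R : realType) (w a n : nat) (G : input n).

Lemma run_halts Qf (Bad : state -> R) t e cf :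
  run w a G Qf Bad t e cf -> halts_within w a G Qf t cf.
Proof.
elim=> {t e cf} [t e s Qs _|t e cf cost k f g Hs ct _ _ IH].
  exact: halts_now.
exact: (halts_step Hs ct).
Qed.

Lemma prob_upto_bounds (E : state -> Prop) m cf :
  0 <= prob_upto R w a G E m cf <= 1.
Proof.
elim: m cf => [|m IH] cf /=; case: (step w a G cf) => [|_ k f].
- by case: (`[< _ >]); rewrite ?lexx ?ler01.
- by rewrite lexx ler01.
- by case: (`[< _ >]); rewrite ?lexx ?ler01.
have k0 : (0 : R) < k.+1%:R by rewrite ltr0Sn.
apply/andP; split.
  by apply: divr_ge0; [apply: sumr_ge0 => i _; case/andP: (IH (f i))|exact: ltW].
rewrite ler_pdivrMr // mul1r.
apply: (le_trans (ler_sum _ (fun i _ => proj2 (andP (IH (f i)))))).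
by rewrite sumr_const card_ord.
Qed.

Lemma prob_uptoS (E : state -> Prop) m cf :
  prob_upto R w a G E m cf <= prob_upto R w a G E m.+1 cf.
Proof.
elim: m cf => [|m IH] cf.
  rewrite /=; case: (step w a G cf) => [//|_ k f].
  apply: divr_ge0; last by rewrite ler0n.
  by apply: sumr_ge0 => i _; case/andP: (prob_upto_bounds E 0 (f i)).
move: IH; rewrite /= => IH; case: (step w a G cf) => [//|_ k f].
by rewrite ler_pM2r ?invr_gt0 ?ltr0Sn//; apply: ler_sum => i _; exact: IH.
Qed.

Lemma prob_upto_le (E : state -> Prop) m m' cf : (m <= m')%N ->
  prob_upto R w a G E m cf <= prob_upto R w a G E m' cf.
Proof.
move=> /subnK <-; elim: (m' - m)%N => // k IH.
by rewrite addSn; apply: (le_trans IH); exact: prob_uptoS.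
Qed.

(** Averaging [1 - g i] over the outcomes turns the bound on the expectation of [Bad] into a lower
    bound on the probability of [E]. Branching is finite, so a finite depth suffices. *)
Lemma run_prob_upto Qf (Bad : state -> R) (E : state -> Prop) t e cf :
  (forall s, Qf s -> 1 - Bad s <= `[< E s >]%:R) ->
  run w a G Qf Bad t e cf ->
  exists m, 1 - e <= prob_upto R w a G E m cf.
Proof.
move=> HE; elim=> {t e cf} [t e s Qs Bs|t e cf cost k f g Hs ct ge _ IH].
  exists 0%N; rewrite /=; apply: le_trans (HE s Qs).
  by rewrite lerD2l lerN2.
have [m Hm] := choice IH.
(* The outcomes may need different depths; [prob_upto] is monotone in the depth, so the maximum
   serves all. *)
exists (\max_i m i).+1; rewrite /= Hs.
have k0 : (0 : R) < k.+1%:R by rewrite ltr0Sn.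
apply: (@le_trans _ _ ((\sum_i (1 - g i)) / k.+1%:R)).
  rewrite sumrB sumr_const card_ord mulrBl divff ?gt_eqF//.
  by rewrite lerD2l lerN2.
rewrite ler_pM2r ?invr_gt0//; apply: ler_sum => i _.
apply: (le_trans (Hm i)); apply: prob_upto_le.
exact: (@leq_bigmax _ m i).
Qed.

Lemma run_prob Qf (Bad : state -> R) (E : state -> Prop) t e cf :
  (forall s, Qf s -> 1 - Bad s <= `[< E s >]%:R) ->
  run w a G Qf Bad t e cf ->
  1 - e <= prob R w a G E cf.
Proof.
move=> HE /(run_prob_upto HE)[m Hm]; apply: (le_trans Hm).
apply: ub_le_sup; last by exists m.
by exists 1 => _ [k _ <-]; case/andP: (prob_upto_bounds E k cf).
Qed.

Lemma run_mono Qf (Bad : state -> R) t e t' e' cf :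
  run w a G Qf Bad t e cf -> (t <= t')%N -> e <= e' ->
  run w a G Qf Bad t' e' cf.
Proof.
move=> H; elim: H t' e' => {t e cf} [t e s Qs Bs|t e cf cost k f g Hs ct ge _ IH]
  t' e' tt' ee'.
  by apply: run_halt => //; exact: le_trans ee'.
apply: (run_step (g := g) Hs).
- exact: leq_trans tt'.
- exact: le_trans ee'.
by move=> i; apply: IH => //; exact: leq_sub2r.
Qed.

Lemma run_det Qf (Bad : state -> R) t e cost cf cf' :
  step w a G cf = det_step cost cf' -> run w a G Qf Bad t e cf' ->
  run w a G Qf Bad (cost + t) e cf.
Proof.
move=> Hs H; apply: (run_step (g := fun=> e) Hs).
- exact: leq_addr.
- by rewrite big_const_ord /= addr0 divr1.
- by move=> _; rewrite addKn.
Qed.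

End Soundness.

(** * Word arithmetic without overflow *)

Fixpoint evaln (s : state) (e : expr) : nat :=
  match e with
  | Cst x => x
  | Reg r => reg s r
  | Mem e1 => ram s (evaln s e1)
  | Bop o e1 e2 => binop_sem o (evaln s e1) (evaln s e2)
  end.

(* If all stored values are at most [Y], then [e] evaluates to at most
   [Y ^ expr_deg e]. *)
Fixpoint expr_deg (e : expr) : nat :=
  if e is Bop _ e1 e2 then (expr_deg e1 + expr_deg e2)%N else 1%N.

(** The limits 16 and 64 match the assumptions [16 <= Y] and [Y ^ 64 < 2 ^ w] of [evalE]. *)
Fixpoint fits (e : expr) : bool :=
  match e with
  | Cst x => (x <= 16)%N
  | Reg _ => true
  | Mem e1 => fits e1
  | Bop _ e1 e2 => [&& fits e1, fits e2 & expr_deg e1 + expr_deg e2 <= 64]%N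
  end.

Definition small (Y : nat) (s : state) : Prop :=
  (forall r, reg s r <= Y)%N /\ (forall i, ram s i <= Y)%N.

Lemma expr_deg_gt0 e : (0 < expr_deg e)%N.
Proof. by elim: e => //= o e1 IH1 e2 IH2; rewrite addn_gt0 IH1. Qed.

Lemma evalE (w Y : nat) s e : (16 <= Y)%N -> (Y ^ 64 < 2 ^ w)%N ->
  small Y s -> fits e -> (eval w s e = evaln s e)%N.
Proof.
move=> Y16 YD [Hr Hm] He.
suff: (eval w s e = evaln s e) /\ (evaln s e <= Y ^ expr_deg e)%N by case.
have Y1 : (1 < Y)%N by apply: leq_trans Y16.
have YW k : (k <= 64)%N -> (Y ^ k < 2 ^ w)%N.
  by move=> k64; apply: leq_ltn_trans YD; rewrite leq_exp2l.
elim: e He => [x|r|e IH|o e1 IH1 e2 IH2] /=.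
- move=> x16; have xY : (x <= Y ^ 1)%N by apply: leq_trans Y16.
  by rewrite modn_small //; apply: leq_ltn_trans xY (YW 1%N isT).
- by [].
- by move=> /IH[-> _].
case/and3P=> /IH1[-> b1] /IH2[-> b2] D64.
have [g1 g2] := (expr_deg_gt0 e1, expr_deg_gt0 e2).
set x := evaln s e1 in b1 *; set y := evaln s e2 in b2 *.
have P1 : (2 <= Y ^ expr_deg e1)%N by rewrite -(expn0 Y) ltn_exp2l.
have P2 : (2 <= Y ^ expr_deg e2)%N by rewrite -(expn0 Y) ltn_exp2l.
(* For a sum, [x + y <= p1 + p2 <= p1 * p2], where the second inequality needs both powers to be at
   least 2. *)
have B : (binop_sem o x y <= Y ^ (expr_deg e1 + expr_deg e2))%N.
  rewrite expnD; move: P1 P2 b1 b2.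
  move: (Y ^ expr_deg e1)%N (Y ^ expr_deg e2)%N => p1 p2 P1 P2 b1 b2.
  have P3 : (p1 <= p1 * p2)%N by rewrite leq_pmulr //; exact: ltnW.
  case: o => /=.
  - by clear - P1 P2 b1 b2; nia.
  - by apply: leq_trans P3; apply: leq_trans (leq_subr _ _) _.
  - exact: leq_mul.
  - by apply: leq_trans P3; apply: leq_trans (leq_div _ _) _.
  - by apply: leq_trans P3; apply: leq_trans (leq_mod _ _) _.
  - by apply: leq_trans (leq_b1 _) _; apply: leq_trans P3; exact: ltnW.
  - by apply: leq_trans (leq_b1 _) _; apply: leq_trans P3; exact: ltnW.
by split=> //; rewrite modn_small //; apply: leq_ltn_trans B (YW _ D64).
Qed.

Lemma small_set_reg Y s r x : small Y s -> (x <= Y)%N -> small Y (set_reg s r x).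
Proof. by move=> [Hr Hm] xY; split=> //= i; rewrite /upd; case: ifP. Qed.

Lemma small_set_mem Y s i x : small Y s -> (x <= Y)%N -> small Y (set_mem s i x).
Proof. by move=> [Hr Hm] xY; split=> //= j; rewrite /upd; case: ifP. Qed.

(** * The input graph, by vertex numbers *)

Section NatGraph.
Variables (n : nat) (G : input n).

Lemma mem_nbr_list u v : (v \in nbr_list G u) = adj_test G u v.
Proof.
rewrite /nbr_list /adj_test; case: insubP => [i _ _|_]; last by rewrite in_nil.
case: insubP => [j _ <-|vn].
  by rewrite mem_map ?nbrsE //; exact: val_inj.
by apply/negP => /mapP[j _ vj]; rewrite vj ltn_ord in vn.
Qed.

Lemma adj_test_ord (i j : 'I_n) : adj_test G i j = G i j.
Proof. by rewrite /adj_test !valK. Qed.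

Lemma adj_test_sym u v : adj_test G u v = adj_test G v u.
Proof.
rewrite /adj_test; case: insubP => [i _ _|_]; case: insubP => // j _ _.
exact: adj_sym.
Qed.

Lemma adj_test_ltl u v : adj_test G u v -> (u < n)%N.
Proof. by rewrite /adj_test; case: insubP. Qed.

Lemma adj_test_ltr u v : adj_test G u v -> (v < n)%N.
Proof. by rewrite adj_test_sym; exact: adj_test_ltl. Qed.

Lemma nbr_list_uniq u : uniq (nbr_list G u).
Proof.
rewrite /nbr_list; case: insubP => // i _ _.
by rewrite map_inj_uniq ?nbrs_uniq //; exact: val_inj.
Qed.

Lemma size_nbr_list u : size (nbr_list G u) = (\sum_(x < n) adj_test G u x)%N.
Proof.
rewrite -(big_mkord xpredT (fun x => adj_test G u x : nat)).
rewrite (eq_bigr (fun x => if adj_test G u x then 1%N else 0%N)); last first.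
  by move=> x _; case: adj_test.
rewrite -big_mkcond sum1_count /index_iota subn0 -size_filter.
apply: perm_size.
apply: uniq_perm; rewrite ?nbr_list_uniq ?filter_uniq ?iota_uniq // => x.
rewrite mem_filter mem_iota mem_nbr_list add0n /=.
by case H: (adj_test G u x) => //=; rewrite (adj_test_ltr H).
Qed.

Lemma size_nbr_list_le u : (size (nbr_list G u) <= n)%N.
Proof.
rewrite size_nbr_list; apply: (@leq_trans (\sum_(x < n) 1)).
  by apply: leq_sum => x _; exact: leq_b1.
by rewrite sum1_card card_ord.
Qed.

Lemma nth_nbr_list_le u i : (nth 0 (nbr_list G u) i <= n)%N.
Proof.
case: (ltnP i (size (nbr_list G u))) => H; last by rewrite nth_default.
by apply/ltnW/(@adj_test_ltr u); rewrite -mem_nbr_list mem_nth.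
Qed.

End NatGraph.

(** * Expected-value triples *)

Definition For (i : nat) (e : expr) (body : cmd) : cmd :=
  Seq (Assign i (Cst 0))
      (While (Bop Lt (Reg i) e)
             (Seq body (Assign i (Bop Add (Reg i) (Cst 1))))).

Section Triples.
Variables (R : realType) (w a n : nat) (G : input n) (Y : nat).

(* From [s], [c] terminates within cost [t] in a state satisfying [Q], and the
   expectation of [f] there is at most [e]. *)
Definition triple (t : nat) (e : R) (c : cmd) (s : state) (Q : state -> Prop)
    (f : state -> R) : Prop :=
  small Y s -> forall Qf Bad cs t',
    (forall s', small Y s' -> Q s' -> run w a G Qf Bad t' (f s') (cs, s')) ->
    run w a G Qf Bad (t + t') e (c :: cs, s).

(** Quantifying over [e] says that the command passes on unchanged whatever error bound holds before
    it. *)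
Definition dtriple (t : nat) (c : cmd) (s : state) (Q : state -> Prop) : Prop :=
  forall e : R, triple t e c s Q (fun=> e).

Lemma triple_mono t e c s Q f t' e' (Q' : state -> Prop) f' :
  triple t e c s Q f -> (t <= t')%N -> e <= e' ->
  (forall s', small Y s' -> Q s' -> Q' s' /\ f' s' <= f s') ->
  triple t' e' c s Q' f'.
Proof.
move=> H tt' ee' QQ' ss Qf Bad cs t0 Hk.
apply: (@run_mono _ _ _ _ _ _ _ (t + t0) e) => //; last by rewrite leq_add2r.
apply: H => // s' ss' Qs'; have [Qs'' ff'] := QQ' _ ss' Qs'.
exact: run_mono (Hk _ ss' Qs'') _ ff'.
Qed.

Lemma dtriple_mono t c s Q t' (Q' : state -> Prop) :
  dtriple t c s Q -> (t <= t')%N -> (forall s', small Y s' -> Q s' -> Q' s') ->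
  dtriple t' c s Q'.
Proof.
by move=> H tt' QQ' e; apply: triple_mono (H e) tt' _ _ => // s' ss' /(QQ' _ ss').
Qed.

Lemma dtriple_triple t c s Q f e :
  dtriple t c s (fun s' => Q s' /\ f s' <= e) -> triple t e c s Q f.
Proof. by move=> H; apply: triple_mono (H e) (leqnn _) _ _ => // s' _ []. Qed.

Lemma triple_seq t1 t2 e c1 c2 s Q1 f1 Q f :
  triple t1 e c1 s Q1 f1 ->
  (forall s1, small Y s1 -> Q1 s1 -> triple t2 (f1 s1) c2 s1 Q f) ->
  triple (t1 + t2).+1 e (Seq c1 c2) s Q f.
Proof.
move=> H1 H2 ss Qf Bad cs t' Hk; rewrite addSn -add1n.
apply: (run_det (cf' := (c1 :: c2 :: cs, s))) => //.
by rewrite -addnA; apply: H1 => // s1 ss1 /(H2 _ ss1); exact.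
Qed.

Lemma dtriple_seq t1 t2 c1 c2 s Q :
  dtriple t1 c1 s (fun s1 => dtriple t2 c2 s1 Q) ->
  dtriple (t1 + t2).+1 (Seq c1 c2) s Q.
Proof. by move=> H e; apply: triple_seq (H e) _ => s1 _; exact. Qed.

Lemma dtriple_skip s (Q : state -> Prop) : Q s -> dtriple 1 Skip s Q.
Proof.
move=> Qs e ss Qf Bad cs t' Hk.
by apply: (run_det (cf' := (cs, s))) => //; exact: Hk.
Qed.

Hypotheses (Y16 : (16 <= Y)%N) (YW : (Y ^ 64 < 2 ^ w)%N) (nY : (n <= Y)%N).

Let ev s e : small Y s -> fits e -> eval w s e = evaln s e.
Proof. exact: evalE. Qed.

Lemma dtriple_assign r e s (Q : state -> Prop) : fits e -> (evaln s e <= Y)%N ->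
  Q (set_reg s r (evaln s e)) -> dtriple 1 (Assign r e) s Q.
Proof.
move=> Fe eY Qs x ss Qf Bad cs t' Hk.
apply: (run_det (cf' := (cs, set_reg s r (evaln s e)))).
  by rewrite /step /= ev.
by apply: Hk => //; exact: small_set_reg.
Qed.

Lemma dtriple_store e1 e2 s (Q : state -> Prop) : fits e1 -> fits e2 ->
  (evaln s e2 <= Y)%N ->
  Q (set_mem s (evaln s e1) (evaln s e2)) -> dtriple 1 (Store e1 e2) s Q.
Proof.
move=> F1 F2 eY Qs x ss Qf Bad cs t' Hk.
apply: (run_det (cf' := (cs, set_mem s (evaln s e1) (evaln s e2)))).
  by rewrite /step /= !ev.
by apply: Hk => //; exact: small_set_mem.
Qed.

Lemma dtriple_degree r e s (Q : state -> Prop) : fits e ->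
  Q (set_reg s r (size (nbr_list G (evaln s e)))) -> dtriple a (Degree r e) s Q.
Proof.
move=> F Qs x ss Qf Bad cs t' Hk.
apply: (run_det (cf' := (cs, set_reg s r (size (nbr_list G (evaln s e)))))).
  by rewrite /step /= ev.
apply: Hk => //; apply: small_set_reg => //.
exact: leq_trans (size_nbr_list_le _ _) nY.
Qed.

Lemma dtriple_neighbor r e1 e2 s (Q : state -> Prop) : fits e1 -> fits e2 ->
  Q (set_reg s r (nth 0%N (nbr_list G (evaln s e1)) (evaln s e2))) ->
  dtriple a (Neighbor r e1 e2) s Q.
Proof.
move=> F1 F2 Qs x ss Qf Bad cs t' Hk.
apply: (run_det (cf' :=
  (cs, set_reg s r (nth 0%N (nbr_list G (evaln s e1)) (evaln s e2))))).
  by rewrite /step /= !ev.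
apply: Hk => //; apply: small_set_reg => //.
exact: leq_trans (nth_nbr_list_le _ _ _) nY.
Qed.

Lemma dtriple_adjacent r e1 e2 s (Q : state -> Prop) : fits e1 -> fits e2 ->
  Q (set_reg s r (adj_test G (evaln s e1) (evaln s e2))) ->
  dtriple a (Adjacent r e1 e2) s Q.
Proof.
move=> F1 F2 Qs x ss Qf Bad cs t' Hk.
apply: (run_det (cf' :=
  (cs, set_reg s r (adj_test G (evaln s e1) (evaln s e2))))).
  by rewrite /step /= !ev.
apply: Hk => //; apply: small_set_reg => //.
by apply: leq_trans (leq_b1 _) _; apply: leq_trans Y16.
Qed.

Lemma dtriple_if t e c1 c2 s Q : fits e ->
  (evaln s e != 0%N -> dtriple t c1 s Q) -> (evaln s e = 0%N -> dtriple t c2 s Q) ->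
  dtriple t.+1 (If e c1 c2) s Q.
Proof.
move=> F H1 H2 x ss Qf Bad cs t' Hk; rewrite addSn -add1n.
apply: (run_det (cf' := ((if evaln s e != 0%N then c1 else c2) :: cs, s))).
  by rewrite /step /= ev.
by case: eqP => /= He; [apply: H2|apply: H1 => //; apply/eqP].
Qed.

Lemma triple_rand r e s Q (f : state -> R) k x : fits e -> evaln s e = k.+1 ->
  (k <= Y)%N -> (forall i, (i <= k)%N -> Q (set_reg s r i)) ->
  (\sum_(i < k.+1) f (set_reg s r i)) / k.+1%:R <= x ->
  triple 1 x (Rand r e) s Q f.
Proof.
move=> F ek kY HQ Hf ss Qf Bad cs t' Hk.
apply: (@run_step _ _ _ _ _ _ _ _ _ _ 1%N k
  (fun i => (cs, set_reg s r i)) (fun i => f (set_reg s r i))) => //.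
  by rewrite /step /= ev // ek.
move=> i; rewrite add1n subn1 /=; have ik : (i <= k)%N by rewrite -ltnS.
by apply: Hk; [apply: small_set_reg => //; exact: leq_trans kY|exact: HQ].
Qed.

(** The form [(size l).-1.+1] also covers an empty list, whose single outcome is the default 0. *)
Lemma triple_rand_neighbor r e s Q (f : state -> R) x l : fits e ->
  nbr_list G (evaln s e) = l ->
  (forall i, (i <= (size l).-1)%N -> Q (set_reg s r (nth 0%N l i))) ->
  (\sum_(i < (size l).-1.+1) f (set_reg s r (nth 0%N l i)))
    / (size l).-1.+1%:R <= x ->
  triple a x (RandNeighbor r e) s Q f.
Proof.
move=> F el HQ Hf ss Qf Bad cs t' Hk.
have lY j : (nth 0 l j <= Y)%N.
  by rewrite -el; exact: leq_trans (nth_nbr_list_le _ _ _) nY.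
apply: (@run_step _ _ _ _ _ _ _ _ _ _ a (size l).-1
  (fun i => (cs, set_reg s r (nth 0%N l i)))
  (fun i => f (set_reg s r (nth 0%N l i)))) => //.
- by rewrite /step /= ev // el.
- exact: leq_addr.
move=> i; rewrite addKn; apply: Hk; last by apply: HQ; rewrite -ltnS.
exact: small_set_reg.
Qed.

(** The family [f] is a supermartingale indexed by the number of rounds: a round started with
    potential [f k s] ends with expected potential [f k.+1] at most that. *)
Lemma triple_while (I : nat -> state -> Prop) (f : nat -> state -> R) N tb x e c s
    (Q : state -> Prop) fQ :
  fits e ->
  (forall k s, small Y s -> I k s -> evaln s e != 0%N ->
    (k < N)%N /\ triple tb (f k s) c s (I k.+1) (f k.+1)) ->
  (forall k s, small Y s -> I k s -> evaln s e = 0%N -> Q s /\ fQ s <= f k s) ->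
  I 0%N s -> f 0%N s <= x ->
  triple (1 + N * (tb + 1)) x (While e c) s Q fQ.
Proof.
move=> F Hc He I0 f0 ss Qf Bad cs t' Hk; apply: run_mono (leqnn _) f0.
suff H m k s0 : small Y s0 -> I k s0 -> (N <= k + m)%N ->
    run w a G Qf Bad (1 + m * (tb + 1) + t') (f k s0) (While e c :: cs, s0).
  exact: H.
elim: m k s0 {ss I0} => [|m IH] k {}s ss Ik Hm; rewrite -addnA.
  apply: (run_det (cf' :=
    (if evaln s e != 0%N then c :: While e c :: cs else cs, s))).
    by rewrite /step /= ev.
  case: eqP => /= E.
    rewrite mul0n add0n; have [Qs ff] := He _ _ ss Ik E.
    exact: run_mono (Hk _ ss Qs) _ ff.
  (* Without remaining budget [N <= k], so a successful test would contradict [k < N]. *)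
  by have [] := Hc _ _ ss Ik (introN eqP E); lia.
apply: (run_det (cf' :=
    (if evaln s e != 0%N then c :: While e c :: cs else cs, s))).
  by rewrite /step /= ev.
case: eqP => /= E.
  have [Qs ff] := He _ _ ss Ik E.
  by apply: run_mono (Hk _ ss Qs) _ ff; exact: leq_addl.
have [kN T] := Hc _ _ ss Ik (introN eqP E).
have -> : (m.+1 * (tb + 1) + t' = tb + (1 + m * (tb + 1) + t'))%N by lia.
by apply: T => // s' ss' Ik'; apply: IH => //; lia.
Qed.

Lemma triple_for (I : nat -> state -> Prop) (f : nat -> state -> R) N tb x i e c s :
  fits (Bop Lt (Reg i) e) -> (N <= Y)%N ->
  (forall k s, (k <= N)%N -> I k s -> reg s i = k /\ evaln s e = N) ->
  (forall k s, (k < N)%N -> small Y s -> I k s ->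
     triple tb (f k s) c s
       (fun s' => reg s' i = k /\ I k.+1 (set_reg s' i k.+1))
       (fun s' => f k.+1 (set_reg s' i k.+1))) ->
  I 0%N (set_reg s i 0%N) -> f 0%N (set_reg s i 0%N) <= x ->
  triple (3 + N * (tb + 3)) x (For i e c) s (I N) (f N).
Proof.
move=> F NY HI Hc I0 f0.
(* The constant 3 pays for the outer sequence, the initialization and the failing test; each round
   pays for its test, its sequence and the increment. *)
have -> : (3 + N * (tb + 3) = (1 + (1 + N * ((tb + 1).+1 + 1))).+1)%N by lia.
apply: triple_seq.
  apply: (@triple_mono 1%N (f 0%N (set_reg s i 0%N)) _ _
    (fun s' => s' = set_reg s i 0%N) (fun=> f 0%N (set_reg s i 0%N))) => //.
    exact: dtriple_assign.
  by move=> s' _ H; split; [exact: H|rewrite H].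
move=> s0 _ ->.
apply: (@triple_while (fun k s => (k <= N)%N /\ I k s) f) => //.
- move=> k s2 ss2 [kN Ik].
  have [rk eN] := HI _ _ kN Ik; rewrite /= rk eN => H.
  have {}kN : (k < N)%N by move: H; case: (k < N)%N.
  split=> //; apply: triple_seq; first exact: Hc.
  move=> s1 ss1 [r1 I1].
  apply: (@triple_mono 1%N _ _ _ (fun s' => s' = set_reg s1 i k.+1)
    (fun=> f k.+1 (set_reg s1 i k.+1))) => //; last by move=> _ _ ->.
  apply: dtriple_assign => //=; rewrite r1 addn1 //.
  exact: leq_trans NY.
- move=> k s2 ss2 [kN Ik].
  have [rk eN] := HI _ _ kN Ik; rewrite /= rk eN => H.
  suff -> : N = k by [].
  by apply/eqP; rewrite eqn_leq kN andbT leqNgt; move: H; case: (k < N)%N.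
Qed.

Lemma dtriple_for (I : nat -> state -> Prop) N tb i e c s :
  fits (Bop Lt (Reg i) e) -> (N <= Y)%N ->
  (forall k s, (k <= N)%N -> I k s -> reg s i = k /\ evaln s e = N) ->
  (forall k s, (k < N)%N -> small Y s -> I k s ->
     dtriple tb c s (fun s' => reg s' i = k /\ I k.+1 (set_reg s' i k.+1))) ->
  I 0%N (set_reg s i 0%N) -> dtriple (3 + N * (tb + 3)) (For i e c) s (I N).
Proof.
move=> F NY HI Hc I0 x; apply: (@triple_for I (fun _ _ => x)) => // k s0 kN ss Ik.
exact: Hc.
Qed.

End Triples.

(** * The program *)

Local Arguments upd f i x j /.

(* Memory layout, by address modulo 4: center number [j >= 1] is stored at
   [center_at j] (and [M] at address 0), the largest number of a center equal
   to [x] at [key_at x], the cluster of [v] at [cluster_at v] (0 if none), and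
   an edge between clusters [i] and [j] at [pair_at M i j] (0 if none). *)
Definition center_at (j : nat) : nat := (4 * j)%N.
Definition key_at (x : nat) : nat := (4 * x + 1)%N.
Definition cluster_at (v : nat) : nat := (4 * v + 2)%N.
Definition pair_at (M i j : nat) : nat := (4 * (i * (M + 1) + j) + 3)%N.

Definition center_expr (e : expr) : expr := Bop Mul (Cst 4) e.
Definition key_expr (e : expr) : expr := Bop Add (center_expr e) (Cst 1).
Definition cluster_expr (e : expr) : expr := Bop Add (center_expr e) (Cst 2).
Definition pair_expr (eM e1 e2 : expr) : expr :=
  Bop Add
    (center_expr (Bop Add (Bop Mul e1 (Bop Add eM (Cst 1))) e2)) (Cst 3).
(** The added 1 keeps codes nonzero, so that 0 can mark an empty slot. *)
Definition code_expr (en e1 e2 : expr) : expr :=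
  Bop Add (Bop Add (Bop Mul e1 en) e2) (Cst 1).

(* Registers: 0 is n, 1 is q, 2 is r, 3 and 4 serve to compute
   5, the logarithmic factor L; 6 is M, 7 is T; 8 and 9 are loop counters,
   10 a vertex, 11 a degree. *)
Definition setup : cmd :=
  Seq (While (Bop Lt (Bop Mul (Reg 1) (Reg 1)) (Reg 0))
             (Assign 1 (Bop Add (Reg 1) (Cst 1))))
 (Seq (While (Bop Lt (Bop Mul (Bop Mul (Reg 2) (Reg 2)) (Reg 2)) (Reg 0))
             (Assign 2 (Bop Add (Reg 2) (Cst 1))))
 (Seq (Assign 3 (Cst 1))
 (Seq (While (Bop Lt (Reg 3) (Bop Add (Reg 0) (Cst 1)))
             (Seq (Assign 3 (Bop Mul (Reg 3) (Cst 2)))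
                  (Assign 4 (Bop Add (Reg 4) (Cst 1)))))
 (Seq (Assign 5 (Bop Mul (Cst 16) (Reg 4)))
 (Seq (Assign 6 (Bop Mul (Bop Mul (Reg 2) (Reg 2)) (Reg 5)))
 (Seq (Assign 7 (Bop Mul (Reg 1) (Reg 5)))
      (Store (Cst 0) (Reg 6)))))))).

(** If a vertex is drawn again, the later and larger number overwrites its key. *)
Definition draw_centers : cmd :=
  For 8 (Reg 6)
    (Seq (Rand 10 (Reg 0))
    (Seq (Store (center_expr (Bop Add (Reg 8) (Cst 1))) (Reg 10))
         (Store (key_expr (Reg 10)) (Bop Add (Reg 8) (Cst 1))))).

Definition scan_neighbors : cmd :=
  For 9 (Reg 11)
    (Seq (Neighbor 10 (Reg 8) (Reg 9))
         (If (Bop Lt (Mem (cluster_expr (Reg 8))) (Mem (key_expr (Reg 10))))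
             (Store (cluster_expr (Reg 8)) (Mem (key_expr (Reg 10)))) Skip)).

Definition scan_centers : cmd :=
  let j := Bop Add (Bop Sub (Reg 6) (Reg 7)) (Bop Add (Reg 9) (Cst 1)) in
  For 9 (Reg 7)
    (Seq (Adjacent 10 (Mem (center_expr j)) (Reg 8))
         (If (Reg 10) (Store (cluster_expr (Reg 8)) j) Skip)).

Definition form_clusters : cmd :=
  For 8 (Reg 0)
    (Seq (Degree 11 (Reg 8))
         (If (Bop Lt (Reg 11) (Reg 1)) scan_neighbors scan_centers)).

(** The product is nonzero exactly when both ends have a cluster. An isolated vertex draws the
    default 0, but having no cluster it stores nothing. *)
Definition sample_edges : cmd :=
  let cu := Mem (cluster_expr (Reg 8)) in
  let cx := Mem (cluster_expr (Reg 10)) in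
  For 8 (Reg 0)
    (For 9 (Reg 7)
      (Seq (RandNeighbor 10 (Reg 8))
           (If (Bop Mul cu cx)
               (Store (pair_expr (Reg 6) cu cx) (code_expr (Reg 0) (Reg 8) (Reg 10)))
               Skip))).

Definition build_cmd : cmd :=
  Seq setup (Seq draw_centers (Seq form_clusters sample_edges)).

(** Disjunction is a sum and conjunction a product. Slots belong to ordered pairs of clusters, so
    [keep] is evaluated in both directions to make the answer symmetric. *)
Definition query_cmd : cmd :=
  let cu := Mem (cluster_expr (Reg 1)) in
  let cv := Mem (cluster_expr (Reg 2)) in
  let eM := Mem (Cst 0) in
  let keep c1 c2 x1 x2 :=
    Bop Add
      (Bop Add (Bop Eq c1 (Cst 0)) (Bop Eq (Mem (center_expr c1)) x2))
      (Bop Add (Bop Eq (Mem (pair_expr eM c1 c2)) (Cst 0))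
               (Bop Eq (Mem (pair_expr eM c1 c2)) (code_expr (Reg 0) x1 x2))) in
  Seq (Adjacent 3 (Reg 1) (Reg 2))
      (Assign 0 (Bop Lt (Cst 0)
        (Bop Mul (Reg 3)
          (Bop Add (keep cu cv (Reg 1) (Reg 2)) (keep cv cu (Reg 2) (Reg 1)))))).

(** Linearity of expectation: averaging a potential reduces to one estimate per event, while [eps]
    is set aside for another phase. *)
Lemma avg_sum_le (R : realType) (K : nat) (J : finType) (P : pred J) (eps : R)
    (b : 'I_K.+1 -> J -> R) (B : J -> R) :
  (forall p, P p -> (\sum_x b x p) / K.+1%:R <= B p) ->
  (\sum_x (eps + \sum_(p | P p) b x p)) / K.+1%:R <= eps + \sum_(p | P p) B p.
Proof.
move=> H; rewrite big_split /= sumr_const card_ord mulrDl.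
rewrite -[eps *+ _]mulr_natr mulfK ?pnatr_eq0 // lerD2l exchange_big /=.
by rewrite mulr_suml; apply: ler_sum.
Qed.

(** * Drawing the centers and forming the clusters *)

Section Phases.
Variables (R : realType) (w a n : nat) (G : input n) (Y : nat).
Hypotheses (Y16 : (16 <= Y)%N) (YW : (Y ^ 64 < 2 ^ w)%N) (nY : (n <= Y)%N).
Variables (q M T : nat).
Hypotheses (n0 : (0 < n)%N) (MY : (M < Y)%N) (TM : (T <= M)%N)
  (nnY : (n * n + n < Y)%N).

Let adj := adj_test G.
Let deg u := size (nbr_list G u).

Definition params (s : state) : Prop :=
  [/\ reg s 0 = n, reg s 1 = q, reg s 6 = M & reg s 7 = T].

(** The bound [i <= m (key_at _)] and the return from a nonzero key to its center together make the
    key of [x] the largest number of a center placed at [x]. *)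
Definition centers_inv (j : nat) (m : nat -> nat) : Prop :=
  [/\ m (center_at 0) = M,
      forall i, (0 < i <= j)%N -> (m (center_at i) < n)%N,
      forall x, (m (key_at x) <= j)%N &
      forall i, (0 < i <= j)%N -> (i <= m (key_at (m (center_at i))))%N] /\
  [/\ forall x, (0 < m (key_at x))%N -> m (center_at (m (key_at x))) = x,
      forall x, m (cluster_at x) = 0%N &
      forall x, m (4 * x + 3)%N = 0%N].

Definition missed (m : nat -> nat) (v lo hi : nat) : bool :=
  all (fun i => ~~ adj (m (center_at i)) v) (iota lo.+1 (hi - lo)).

Lemma missedP m v lo hi :
  reflect (forall i, (lo < i <= hi)%N -> ~~ adj (m (center_at i)) v)
          (missed m v lo hi).
Proof.
apply: (iffP allP) => H i; have := H i; rewrite mem_iota => {}H Hi; apply: H;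
  by clear -Hi; lia.
Qed.

(** The probability that a uniform center misses the neighborhood of [v]. *)
Definition nonadj_rate (v : nat) : R := 1 - (deg v)%:R / n%:R.

Lemma nonadj_rate_ge0 v : 0 <= nonadj_rate v.
Proof.
rewrite subr_ge0 ler_pdivrMr ?ltr0n // mul1r ler_nat; exact: size_nbr_list_le.
Qed.

Lemma sum_nonadj v :
  \sum_(x < n) ((~~ adj x v)%:R : R) = nonadj_rate v * n%:R.
Proof.
rewrite /nonadj_rate mulrBl mul1r divfK ?pnatr_eq0 -?lt0n //.
rewrite /deg size_nbr_list natr_sum -[X in _ = X%:R - _]card_ord -sum1_card.
rewrite natr_sum -sumrB; apply: eq_bigr => x _; rewrite /adj adj_test_sym.
by case: adj_test => /=; rewrite ?subrr ?subr0.
Qed.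

Variable (A : pred ('I_n * 'I_M.+1)).

(** A pair [(v, t)] encodes the event that the last [t] centers all miss the neighborhood of [v];
    the pairs of interest will be the [heavy] ones. *)
Definition missed_sum (m : nat -> nat) : R :=
  \sum_(p | A p) (missed m p.1 (M - p.2) M)%:R.

(* Expectation of [missed_sum] once the first [j] centers are drawn. *)
Definition miss_pot (j : nat) (m : nat -> nat) : R :=
  \sum_(p | A p) (missed m p.1 (M - p.2) j)%:R
                 * nonadj_rate p.1 ^+ minn p.2 (M - j).

Lemma miss_pot_last m : miss_pot M m = missed_sum m.
Proof. by apply: eq_bigr => p _; rewrite subnn minn0 expr0 mulr1. Qed.

Lemma miss_pot_first m :
  miss_pot 0 m = \sum_(p | A p) nonadj_rate p.1 ^+ p.2.
Proof.
apply: eq_bigr => p _; have := ltn_ord p.2; rewrite ltnS => pM.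
by rewrite subn0 (minn_idPl pM) /missed sub0n /= mul1r.
Qed.

Lemma centers_inv_step k m x : centers_inv k m -> (x < n)%N ->
  centers_inv k.+1 (upd (upd m (center_at k.+1) x) (key_at x) k.+1).
Proof.
move=> [[c0 cn kj ik] [kc cl pr]] xn.
rewrite /centers_inv /upd /center_at /key_at /cluster_at.
split; [split=> [|i Hi|y|i Hi]|split=> y]; rewrite /=.
- by rewrite !ifF //; lia.
- rewrite ifF; last by lia.
  by case: eqP => // ?; apply: cn; lia.
- case: eqP => // ?; rewrite ifF; last by lia.
  by apply: leq_trans (kj y) _.
- have -> : (4 * i == 4 * x + 1)%N = false by lia.
  case: (4 * i =P 4 * k.+1)%N => [E|E]; first by rewrite eqxx; lia.
  have Hi' : (0 < i <= k)%N by lia.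
  case: eqP => [_|_]; first by lia.
  by rewrite ifF ?ik //; lia.
- have N z : (4 * y + 1 == 4 * z)%N = false by lia.
  rewrite !N; case: (4 * y + 1 =P 4 * x + 1)%N => [E _|E].
    by rewrite ifF ?eqxx; [lia|lia].
  move=> H; have := kj y; have := kc y; rewrite /key_at /center_at => /(_ H) E2 E3.
  by rewrite !ifF //; lia.
- by rewrite !ifF ?cl //; lia.
- by rewrite !ifF ?pr //; lia.
Qed.

Lemma missed_step k m x v lo :
  missed (upd (upd m (center_at k.+1) x) (key_at x) k.+1) v lo k.+1 =
  missed m v lo k && ((lo <= k)%N ==> ~~ adj x v).
Proof.
have Hu i : (upd (upd m (center_at k.+1) x) (key_at x) k.+1) (center_at i) =
            if i == k.+1 then x else m (center_at i).
  rewrite /upd ifF; last by rewrite /center_at /key_at; lia.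
  by rewrite /center_at eqn_mul2l.
apply/missedP/andP => [H|[/missedP H1 /implyP H2] i Hi]; last first.
  rewrite Hu; case: eqP => [ik|]; first by apply: H2; lia.
  by move=> ?; apply: H1; lia.
split.
  apply/missedP => i Hi; have := H i; rewrite Hu ifF; last by lia.
  by apply; lia.
by apply/implyP => lk; have := H k.+1; rewrite Hu eqxx; apply; lia.
Qed.

(** [miss_pot] does not increase in expectation along the draws, and ends as [missed_sum]. *)
Lemma draw_centers_spec eps s : params s -> centers_inv 0 (ram s) ->
  triple w a G Y (3 + M * 8) (eps + \sum_(p | A p) nonadj_rate p.1 ^+ p.2)
    draw_centers s
    (fun s' => params s' /\ centers_inv M (ram s'))
    (fun s' => eps + missed_sum (ram s')).
Proof.
move=> Ps Cs.
pose I j s := [/\ params s, reg s 8 = j & centers_inv j (ram s)].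
pose f j s := eps + miss_pot j (ram s).
apply: (@triple_mono _ _ _ _ _ _ (3 + M * (5 + 3)) (f 0%N s) _ _ (I M) (f M)).
- apply: (@triple_for _ _ _ _ _ _ Y16 YW nY I f) => //.
  + exact: ltnW.
  + by move=> k s0 _ [[_ _ H _] -> _]; rewrite /= H.
  + move=> k {Ps Cs}s kM ss [Ps r8 Cs].
    have [H0 H1 H6 H7] := Ps.
    (* The potential between the draw and the two stores, when the new center is only in register
       10. *)
    pose fmid s1 := eps + \sum_(p | A p)
      (missed (ram s1) p.1 (M - p.2) k
         && ((M - p.2 <= k)%N ==> ~~ adj (reg s1 10) p.1))%:R
      * nonadj_rate p.1 ^+ minn p.2 (M - k.+1).
    apply: (@triple_seq _ _ _ _ _ _ 1 3 _ _ _ _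
      (fun s1 => exists2 x, (x < n)%N & s1 = set_reg s 10 x) fmid).
      apply: (@triple_rand _ _ _ _ _ _ Y16 YW _ _ _ _ _ n.-1) => //=.
      * by rewrite H0 prednK.
      * by apply: leq_trans nY; exact: leq_pred.
      * by move=> x Hx; exists x => //; rewrite -(prednK n0) ltnS.
      apply: avg_sum_le => p Ap; rewrite -mulr_suml /= prednK //.
      rewrite ler_pdivrMr ?ltr0n //.
      case: (missed _ _ _ k); last by rewrite big1 ?mul0r // mulr0n !mul0r.
      rewrite /= mul1r; have pM := ltn_ord p.2.
      (* Once the window of the last [p.2] centers has begun, a draw spends one factor
         [nonadj_rate]; before that the exponent stays [p.2]. *)
      case: leqP => /= lk.
        have -> : minn p.2 (M - k) = (minn p.2 (M - k.+1)).+1.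
          clear - kM pM lk; move: (nat_of_ord p.2) pM lk => t pM lk; lia.
        rewrite sum_nonadj exprSr mulrC mulrA.
        by [].
      rewrite sumr_const card_ord mulrC.
      suff -> : minn p.2 (M - k) = minn p.2 (M - k.+1) by [].
      by clear - kM pM lk; move: (nat_of_ord p.2) pM lk => t pM lk; lia.
    move=> s1 _ [x xn ->]; apply: dtriple_triple.
    apply: (@dtriple_seq _ _ _ _ _ _ 1 1).
    apply: dtriple_store => //=; first by apply: leq_trans nY; exact: ltnW.
    apply: dtriple_store => //=; rewrite r8 addn1 ?(leq_trans kM) //; first exact: ltnW.
    have E2 := missed_step k (ram s) x; have E := centers_inv_step Cs xn.
    do !split=> //.
    rewrite /f /fmid lerD2l; apply: ler_sum => p _ /=.
    by rewrite E2.
- by [].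
- by rewrite /f miss_pot_first.
- by move=> s' _ [Ps' _ Cs']; rewrite /f miss_pot_last.
Qed.

(** Maximality is claimed only among the examined centers: all of them if [deg v < q], otherwise the
    last [T]. *)
Definition cluster_ok (S : nat -> nat) (v c : nat) : Prop :=
  [/\ (c <= M)%N, (0 < c)%N -> adj (S c) v &
      forall i, (c < i <= M)%N -> (deg v < q)%N \/ (M - T < i)%N ->
        ~~ adj (S i) v].

Definition cluster_frame (m : nat -> nat) (v : nat) (s : state) : Prop :=
  [/\ params s, reg s 8 = v &
      forall i, i != cluster_at v -> ram s i = m i].

Lemma center_cluster i v : center_at i != cluster_at v.
Proof. by rewrite /center_at /cluster_at; apply/eqP; lia. Qed.

Lemma key_cluster x v : key_at x != cluster_at v.
Proof. by rewrite /key_at /cluster_at; apply/eqP; lia. Qed.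

Hypothesis qT : (q <= T)%N.

Lemma scan_neighbors_spec m v s :
  (forall x, (m (key_at x) <= M)%N) ->
  (forall i, (0 < i <= M)%N -> (i <= m (key_at (m (center_at i))))%N) ->
  (forall x, (0 < m (key_at x))%N -> m (center_at (m (key_at x))) = x) ->
  cluster_frame m v s -> ram s (cluster_at v) = 0%N ->
  reg s 11 = deg v -> (deg v < q)%N ->
  dtriple R w a G Y (3 + T * (a + 6)) scan_neighbors s
    (fun s' => cluster_frame m v s' /\
       cluster_ok (fun j => m (center_at j)) v (ram s' (cluster_at v))).
Proof.
move=> kM ik kc Fs cs0 r11 dq.
pose I k s := [/\ cluster_frame m v s, reg s 9 = k, reg s 11 = deg v &
  let c := ram s (cluster_at v) in
  [/\ (c <= M)%N, (0 < c)%N -> adj (m (center_at c)) v &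
    forall j, (j < k)%N -> (m (key_at (nth 0%N (nbr_list G v) j)) <= c)%N]].
apply: (@dtriple_mono _ _ _ _ _ _ (3 + deg v * (a + 3 + 3)) _ _ (I (deg v))).
- apply: (@dtriple_for _ _ _ _ _ _ Y16 YW nY I) => //.
  + by apply: leq_trans nY; exact: size_nbr_list_le.
  + by move=> k s0 _ [_ H9 H11 _].
  + move=> k s0 kd ss [F0 r9 r11' [cM ca ck]]; have [P0 r8 fr] := F0.
    have -> : (a + 3 = (a + 2).+1)%N by rewrite addn3 addn2.
    apply: dtriple_seq; apply: dtriple_neighbor => //=; rewrite r8 r9.
    set x := nth 0%N _ k.
    have kx : ram s0 (key_at x) = m (key_at x) by rewrite fr ?key_cluster.
    have ax : adj x v.
      by rewrite /adj adj_test_sym -mem_nbr_list mem_nth.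
    apply: dtriple_if => //= H.
      apply: dtriple_store => //=; first by case: ss => _; apply.
      rewrite r8 -/(cluster_at v) -/(key_at x) kx.
      have {}H : (ram s0 (cluster_at v) < m (key_at x))%N.
        by move: H; rewrite r8 -/(cluster_at v) -/(key_at x) kx; case: (_ < _)%N.
      split=> //; split=> //=.
        split=> //= i /negPf iv; rewrite iv; exact: fr (negbT iv).
      rewrite eqxx; split=> //.
        by move=> ?; rewrite kc //.
      move=> j; rewrite ltnS leq_eqVlt => /orP[/eqP -> //|/ck Hj].
      exact: leq_trans Hj (ltnW H).
    apply: dtriple_skip; split=> //; split=> //; split=> //=.
    have {}H : (m (key_at x) <= ram s0 (cluster_at v))%N.
      by move: H; rewrite r8 -/(cluster_at v) -/(key_at x) kx; case: ltnP.
    by move=> j; rewrite ltnS leq_eqVlt => /orP[/eqP -> //|/ck].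
  + by split=> //=; rewrite cs0.
(* Here [deg v < q <= T], so both ways of finding the cluster share one time bound. *)
- rewrite leq_add2l; apply: leq_mul; first by apply: leq_trans qT; exact: ltnW.
  by rewrite -addnA.
move=> s' _ [F' _ _ [cM ca ck]]; split=> //; split=> // i /andP[ci iM] _.
(* A center [i] adjacent to [v] sits at a scanned neighbor, whose key is at least [i] and at most
   the final maximum. *)
apply/negP => ai; have vi : m (center_at i) \in nbr_list G v.
  by rewrite mem_nbr_list adj_test_sym.
have := ck (index (m (center_at i)) (nbr_list G v)).
rewrite index_mem nth_index // => /(_ vi); have := ik i; lia.
Qed.

(** Numbers are tried in increasing order, so each hit may overwrite the previous one. As
    [q <= deg v], only the last [T] centers matter for [cluster_ok]. *)
Lemma scan_centers_spec m v s :
  cluster_frame m v s -> ram s (cluster_at v) = 0%N -> (q <= deg v)%N ->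
  dtriple R w a G Y (3 + T * (a + 6)) scan_centers s
    (fun s' => cluster_frame m v s' /\
       cluster_ok (fun j => m (center_at j)) v (ram s' (cluster_at v))).
Proof.
move=> Fs cs0 dq.
pose I k s := [/\ cluster_frame m v s, reg s 9 = k &
  let c := ram s (cluster_at v) in
  [/\ (c <= M - T + k)%N, (0 < c)%N -> adj (m (center_at c)) v &
    forall i, (c < i <= M - T + k)%N -> (M - T < i)%N ->
      ~~ adj (m (center_at i)) v]].
apply: (@dtriple_mono _ _ _ _ _ _ (3 + T * (a + 3 + 3)) _ _ (I T)).
- apply: (@dtriple_for _ _ _ _ _ _ Y16 YW nY I) => //.
  + by apply: leq_trans (ltnW MY).
  + by move=> k s0 _ [[[_ _ _ H7] _ _] H9 _].
  + move=> k s0 kd ss [F0 r9 [cM ca ck]]; have [P0 r8 fr] := F0.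
    have [_ _ r6 r7] := P0.
    have -> : (a + 3 = (a + 2).+1)%N by rewrite addn3 addn2.
    apply: dtriple_seq; apply: dtriple_adjacent => //=; rewrite r8 r9 r6 r7.
    set i := (M - T + (k + 1))%N; rewrite -/(center_at i) fr ?center_cluster //.
    have Ei : i = (M - T + k).+1 by rewrite /i; lia.
    have iM : (i <= M)%N by lia.
    apply: dtriple_if => //= H.
      apply: dtriple_store => //=; rewrite r6 r7 r9 -/i; first by lia.
      rewrite r8 -/(cluster_at v).
      split=> //; split=> //=.
        split=> //= j /negPf jv; rewrite jv; exact: fr (negbT jv).
      rewrite eqxx; split=> //; first by lia.
        by move=> _; move: H; rewrite /adj; case: adj_test.
      by move=> j; lia.
    apply: dtriple_skip; split=> //; split=> //; split=> //=; first by lia.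
    move=> j Hj1 Hj2; case: (ltngtP j i) => Hj; first by apply: ck; lia.
      by lia.
    by rewrite Hj; move: H; rewrite /adj; case: adj_test.
  + by split=> //=; rewrite cs0; split=> //; lia.
- by rewrite -addnA.
move=> s' _ [F' _ [cM ca ck]]; rewrite subnK // in cM ck; split=> //; split=> // i Hi.
by case=> [|Hi2]; [lia|exact: ck].
Qed.

(** The last clause lets later hypotheses on clusters range over all numbers instead of vertices. *)
Lemma form_clusters_spec s : params s -> centers_inv M (ram s) ->
  dtriple R w a G Y (3 + n * (a + 8 + T * (a + 6))) form_clusters s
    (fun s' => [/\ params s',
       forall i, (i %% 4 != 2)%N -> ram s' i = ram s i,
       forall v, (v < n)%N ->
         cluster_ok (fun j => ram s (center_at j)) v (ram s' (cluster_at v)) &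
       forall v, (n <= v)%N -> ram s' (cluster_at v) = 0%N]).
Proof.
move=> Ps [[c0 cn kj ik] [kc cl pr]].
pose I k s1 := [/\ params s1, reg s1 8 = k,
  forall i, (i %% 4 != 2)%N -> ram s1 i = ram s i,
  forall v, (v < k)%N ->
         cluster_ok (fun j => ram s (center_at j)) v (ram s1 (cluster_at v)) &
       forall v, (k <= v)%N -> ram s1 (cluster_at v) = 0%N].
have m_center i : (center_at i %% 4 != 2)%N by rewrite /center_at; lia.
have m_key i : (key_at i %% 4 != 2)%N by rewrite /key_at; lia.
apply: (@dtriple_mono _ _ _ _ _ _
  (3 + n * ((a + (3 + T * (a + 6)).+1).+1 + 3)) _ _ (I n)).
- apply: (@dtriple_for _ _ _ _ _ _ Y16 YW nY I) => //.
  + by move=> k s1 _ [[H0 _ _ _] H8 _ _ _].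
  + move=> v s1 vn ss [P1 r8 fr ok z]; have [r0 r1 r6 r7] := P1.
    apply: dtriple_seq; apply: dtriple_degree => //=; rewrite r8 -/(deg v).
    set s2 := set_reg s1 11 (deg v).
    have post s' : cluster_frame (ram s1) v s' /\
       cluster_ok (fun j => ram s1 (center_at j)) v (ram s' (cluster_at v)) ->
       reg s' 8 = v /\ I v.+1 (set_reg s' 8 v.+1).
      move=> [[P' r8' fr'] ok']; split=> //; split=> //=.
      * move=> i Hi; rewrite fr' ?fr //; apply: contraNneq Hi => ->.
        by rewrite /cluster_at; lia.
      * move=> x; rewrite ltnS leq_eqVlt => /orP[/eqP ->|xv].
          case: ok' => o1 o2 o3; split=> //.
            by move=> Hc; rewrite -fr //; exact: o2.
          by move=> i Hi1 Hi2; rewrite -fr //; exact: o3.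
        rewrite fr'; first exact: ok.
        by rewrite /cluster_at; apply/eqP; lia.
      * move=> x xv; rewrite fr' ?z //; first exact: ltnW.
        by rewrite /cluster_at; apply/eqP; lia.
    have F2 : cluster_frame (ram s1) v s2 by split.
    have z2 : ram s2 (cluster_at v) = 0%N by exact: z.
    apply: dtriple_if => //= H.
      apply: dtriple_mono (leqnn _) (fun s' _ => post s').
      apply: scan_neighbors_spec => //.
      * by move=> x; rewrite fr.
      * by move=> i Hi; rewrite !fr //; exact: ik.
      * by move=> x; rewrite !fr //; exact: kc.
      * by move: H; rewrite r1; case: (_ < _)%N.
    apply: dtriple_mono (leqnn _) (fun s' _ => post s').
    apply: scan_centers_spec => //.
    by move: H; rewrite r1; case: ltnP.
  + by split=> //= x _; exact: cl.
- by rewrite leq_add2l leq_mul2l; apply/orP; right; lia.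
by move=> s' _ [].
Qed.

End Phases.

(** * Sampling edges between clusters *)

Lemma pair_at_inj M i j i' j' : (j <= M)%N -> (j' <= M)%N ->
  pair_at M i j = pair_at M i' j' -> i = i' /\ j = j'.
Proof.
rewrite /pair_at => jM jM' H.
have {}H : (i * (M + 1) + j = i' * (M + 1) + j')%N by lia.
have M0 : (0 < M + 1)%N by rewrite addn1.
have E1 := congr1 (divn^~ (M + 1)%N) H; have E2 := congr1 (modn^~ (M + 1)%N) H.
move: E1 E2; rewrite /= !divnMDl // !modnMDl !divn_small ?addn1 ?ltnS //.
by rewrite !addn0 !modn_small ?addn1.
Qed.

Section Sampling.
Variables (R : realType) (w a n : nat) (G : input n) (Y : nat).
Hypotheses (Y16 : (16 <= Y)%N) (YW : (Y ^ 64 < 2 ^ w)%N) (nY : (n <= Y)%N).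
Variables (q M T : nat) (m : nat -> nat).
Hypotheses (MY : (M < Y)%N) (TM : (T <= M)%N) (nnY : (n * n + n < Y)%N).

Let adj := adj_test G.
Let deg u := size (nbr_list G u).
Let c v := m (cluster_at v).

Hypotheses (cM : forall v, (c v <= M)%N)
  (cdeg : forall u, (0 < c u)%N -> (0 < deg u)%N).

(** [m] is the memory when sampling starts. Sampling writes only at addresses congruent to 3 modulo
    4, so the clusters remain those of [m]. *)
Definition pairs_inv (s : state) : Prop :=
  [/\ params n q M T s,
      forall i, (i %% 4 != 3)%N -> ram s i = m i &
      forall i j, (i <= M)%N -> (j <= M)%N -> ram s (pair_at M i j) != 0%N ->
        exists u x, [/\ adj u x, c u = i, c x = j &
                        ram s (pair_at M i j) = (u * n + x + 1)%N]].

Variable P : pred ('I_M.+1 * 'I_M.+1).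
Hypothesis P0 : forall p, P p -> (0 < p.1)%N /\ (0 < p.2)%N.

Definition hits (u j : nat) : nat := count (fun x => c x == j) (nbr_list G u).

(** The probability that one sample at [u] does not land in the pair [p]. *)
Definition miss_rate (u : nat) (p : 'I_M.+1 * 'I_M.+1) : R :=
  if c u == p.1 then 1 - (hits u p.2)%:R / (deg u)%:R else 1.

(** The probability that all samples at vertices from [u] on miss [p]; independence makes it a
    product. *)
Definition miss_rem (u : nat) (p : 'I_M.+1 * 'I_M.+1) : R :=
  \prod_(u <= v < n) miss_rate v p ^+ T.

Lemma miss_rate_ge0 u p : 0 <= miss_rate u p.
Proof.
rewrite /miss_rate; case: ifP => // _; rewrite subr_ge0.
have [d0|d0] := posnP (deg u); first by rewrite d0 invr0 mulr0 ler01.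
by rewrite ler_pdivrMr ?ltr0n // mul1r ler_nat; exact: count_size.
Qed.

Lemma miss_rem_ge0 u p : 0 <= miss_rem u p.
Proof. by apply: prodr_ge0 => v _; rewrite exprn_ge0 ?miss_rate_ge0. Qed.

Lemma avg_miss u p : P p -> c u == p.1 ->
  \sum_(i < (deg u).-1.+1) ((c (nth 0%N (nbr_list G u) i) != p.2)%:R : R)
  = miss_rate u p * (deg u).-1.+1%:R.
Proof.
move=> Pp cu; have d0 : (0 < deg u)%N by apply: cdeg; rewrite (eqP cu); case: (P0 Pp).
rewrite prednK // /miss_rate cu mulrBl mul1r divfK ?pnatr_eq0 -?lt0n //.
rewrite -(big_mkord xpredT (fun i => (c (nth 0%N (nbr_list G u) i) != p.2)%:R)).
rewrite -(big_nth 0%N xpredT (fun x => (c x != p.2)%:R)).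
rewrite /deg -(count_predC (fun x => c x == p.2) (nbr_list G u)) natrD addrC addKr.
rewrite -sum1_count natr_sum [RHS]big_mkcond /=; apply: eq_bigr => x _.
by case: eqP.
Qed.

(* Bounds the expected number of pairs in [P] that stay empty, after [i] of the
   [T] samples at [u]. *)
Definition pairs_pot (u i : nat) (s : state) : R :=
  \sum_(p | P p) (ram s (pair_at M p.1 p.2) == 0%N)%:R
                 * (miss_rem u.+1 p * miss_rate u p ^+ (T - i)).

(** One sample spends one factor [miss_rate u p] for every pair still empty; pairs already recorded
    contribute 0 and stay recorded. *)
Lemma sample_step eps u k s : (k < T)%N -> (u < n)%N -> small Y s ->
  pairs_inv s -> reg s 8 = u -> reg s 9 = k ->
  triple w a G Y (a + 3) (eps + pairs_pot u k s)
    (Seq (RandNeighbor 10 (Reg 8))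
         (If (Bop Mul (Mem (cluster_expr (Reg 8))) (Mem (cluster_expr (Reg 10))))
             (Store (pair_expr (Reg 6) (Mem (cluster_expr (Reg 8)))
                           (Mem (cluster_expr (Reg 10))))
                    (code_expr (Reg 0) (Reg 8) (Reg 10)))
             Skip)) s
    (fun s' => [/\ reg s' 8 = u, reg s' 9 = k & pairs_inv s'])
    (fun s' => eps + pairs_pot u k.+1 s').
Proof.
move=> kT un ss Is r8 r9; have [Ps fr pr] := Is; have [r0 r1 r6 r7] := Ps.
pose f1 s1 := eps + \sum_(p | P p) ((ram s1 (pair_at M p.1 p.2) == 0%N) &&
    ~~ ((c u == p.1) && (c (reg s1 10) == p.2)))%:R
  * (miss_rem u.+1 p * miss_rate u p ^+ (T - k.+1)).
have -> : (a + 3 = (a + 2).+1)%N by rewrite addn3 addn2.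
have Ec x : ram s (4 * x + 2)%N = c x by rewrite fr //; lia.
apply: (@triple_seq _ _ _ _ _ _ _ _ _ _ _ _
  (fun s1 => exists2 x, (0 < c u)%N -> adj u x & s1 = set_reg s 10 x) f1).
  apply: (@triple_rand_neighbor _ _ _ _ _ _ Y16 YW nY _ _ _ _ _ _ (nbr_list G u)).
  - by [].
  - by rewrite /= r8.
  - move=> i Hi; exists (nth 0%N (nbr_list G u) i) => // cu.
    rewrite /adj -mem_nbr_list mem_nth //.
    by rewrite -/(deg u) -(prednK (cdeg cu)) ltnS.
  apply: avg_sum_le => p Pp; rewrite -mulr_suml /=.
  rewrite ler_pdivrMr ?ltr0n //.
  case: (_ == _); last by rewrite big1 ?mul0r // mulr0n !mul0r.
  rewrite /= mul1r; case E: (c u == p.1) => /=.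
    rewrite avg_miss // -(subnSK kT) exprS le_eqVlt; apply/orP; left.
    by apply/eqP; ring.
  rewrite sumr_const card_ord mulrC.
  by rewrite /miss_rate E !expr1n.
move=> s1 _ [x ux ->]; apply: dtriple_triple.
apply: dtriple_if => //=; rewrite r8 !Ec => H.
  have cu : (0 < c u)%N by rewrite lt0n; apply: contraNneq H => ->.
  have xn : (x < n)%N by exact: adj_test_ltr (ux cu).
  have NP i : (i %% 4 != 3)%N -> (i == pair_at M (c u) (c x)) = false.
    by move=> Hi; apply: contraNF Hi => /eqP ->; rewrite /pair_at; lia.
  apply: dtriple_store => //=; rewrite ?r8 ?r0 ?r6 ?Ec -/(pair_at M (c u) (c x)).
    by apply: leq_trans nnY; clear - un xn; nia.
  split; first split=> //.
    split=> //= [i Hi|i j iM jM]; first by rewrite NP // fr.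
    case: (pair_at M i j =P _) => [/(pair_at_inj jM (cM x))[-> ->] _|_]; last exact: pr.
    by exists u, x; split=> //; exact: ux.
  rewrite lerD2l; apply: ler_sum => p _ /=.
  apply: ler_wpM2r.
    by rewrite mulr_ge0 ?miss_rem_ge0 // exprn_ge0 ?miss_rate_ge0.
  rewrite ler_nat; case: (pair_at M p.1 p.2 =P _) => [_|N].
    by rewrite addn1.
  case: (_ == 0)%N => //=; case: andP => // -[/eqP E1 /eqP E2].
  by case: N; rewrite -E1 -E2.
(* When a cluster is 0 nothing is stored, but then the sample lands in no pair of [P], whose
   components are nonzero. *)
apply: dtriple_skip; split=> //=; rewrite lerD2l; apply: ler_sum => p Pp /=.
apply: ler_wpM2r.
    by rewrite mulr_ge0 ?miss_rem_ge0 // exprn_ge0 ?miss_rate_ge0.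
rewrite ler_nat; case: (_ == 0)%N => //=; case: andP => // -[/eqP E1 /eqP E2].
by have [] := P0 Pp; move: H; rewrite -E1 -E2; clear; nia.
Qed.

Lemma sample_edges_spec eps s : pairs_inv s ->
  triple w a G Y (3 + n * (6 + T * (a + 6)))
    (eps + \sum_(p | P p) miss_rem 0 p) sample_edges s pairs_inv
    (fun s' => eps + \sum_(p | P p) (ram s' (pair_at M p.1 p.2) == 0%N)%:R).
Proof.
move=> Is.
have inv_set s0 r x : r \in [:: 8; 9]%N -> pairs_inv s0 -> pairs_inv (set_reg s0 r x).
  by rewrite !inE => /orP[] /eqP -> [[? ? ? ?] ? ?].
pose I u s := pairs_inv s /\ reg s 8 = u.
pose f u s : R := eps + \sum_(p | P p)
  (ram s (pair_at M p.1 p.2) == 0%N)%:R * miss_rem u p.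
apply: (@triple_mono _ _ _ _ _ _
  (3 + n * ((3 + T * ((a + 3) + 3)) + 3)) (f 0%N s) _ _ (I n) (f n)).
- apply: (@triple_for _ _ _ _ _ _ Y16 YW nY I f) => //.
  + by move=> k s0 _ [[[H0 _ _ _] _ _] H8].
  + move=> u s0 un ss [I0 r8].
    pose J k s := [/\ reg s 8 = u, reg s 9 = k & pairs_inv s].
    pose g k s := eps + pairs_pot u k s.
    apply: (@triple_mono _ _ _ _ _ _
      (3 + T * ((a + 3) + 3)) (f u s0) _ _ (J T) (g T)) => //.
      apply: (@triple_for _ _ _ _ _ _ Y16 YW nY J g) => //.
      * by apply: leq_trans TM (ltnW MY).
      * by move=> k s1 _ [_ H9 [[_ _ _ H7] _ _]].
      * move=> k s1 kT ss1 [r8' r9 I1].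
        apply: triple_mono (sample_step (eps := eps) kT un ss1 I1 r8' r9) _ _ _ => //.
        by move=> s' _ [? ? I']; split=> //; split=> //; split=> //; exact: inv_set.
      (* The factor of [u] is split off [miss_rem u], to be spent by the [T] samples at [u]. *)
      * rewrite /g /f lerD2l; apply: ler_sum => p _ /=.
        by rewrite subn0 mulrC [in leRHS]mulrC ler_wpM2r ?ler0n // /miss_rem
             (big_ltn un) mulrC.
    move=> s' _ [r8' _ I']; split; first by split=> //; split=> //; exact: inv_set.
    rewrite /g /f lerD2l; apply: ler_sum => p _ /=.
    by rewrite subnn expr0 mulr1.
- by rewrite leq_add2l leq_mul2l; apply/orP; right; lia.
- rewrite /f lerD2l; apply: ler_sum => p _.
  by rewrite -[leRHS]mul1r ler_wpM2r ?miss_rem_ge0 // lern1 leq_b1.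
move=> s' _ [I' _]; split=> //; rewrite /f lerD2l; apply: ler_sum => p _.
by rewrite /miss_rem big_geq // mulr1.
Qed.

End Sampling.

(** * Sizes *)

Lemma sqrt_up_subproof (n : nat) : exists q, (n <= q * q)%N.
Proof. by exists n; nia. Qed.

Definition sqrt_up (n : nat) : nat := ex_minn (sqrt_up_subproof n).

Lemma cbrt_up_subproof (n : nat) : exists r, (n <= r * r * r)%N.
Proof. by exists n; nia. Qed.

Definition cbrt_up (n : nat) : nat := ex_minn (cbrt_up_subproof n).

Definition log_up (n : nat) : nat := (trunc_log 2 n).+1.

(** With [X = 2 ^ log_up n], the factor 16 makes [expR (- L)] at most [X ^ -16], against at most
    [X ^ 15] bad events. *)
Definition log_factor (n : nat) : nat := (16 * log_up n)%N.
Definition num_centers (n : nat) : nat :=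
  (cbrt_up n * cbrt_up n * log_factor n)%N.
Definition num_samples (n : nat) : nat := (sqrt_up n * log_factor n)%N.
(** This is [X ^ 8], above the edge codes and the number of centers; its 64th power needs 512
    [log_up n] bits, out of the 1001 [log_up n] of a word. *)
Definition value_bound (n : nat) : nat := (2 ^ (8 * log_up n))%N.

Section Sizes.
Variables (n : nat).
Hypothesis n0 : (0 < n)%N.
Local Notation q := (sqrt_up n).
Local Notation r := (cbrt_up n).
Local Notation X := (2 ^ log_up n)%N.

Lemma sqrt_upP : (n <= q * q)%N /\ (forall k, (k < q)%N -> (k * k < n)%N).
Proof.
rewrite /sqrt_up; case: ex_minnP => m Hm Hmin; split=> // k km.
by rewrite ltnNge; apply/negP => /Hmin; rewrite leqNgt km.
Qed.

Lemma cbrt_upP : (n <= r * r * r)%N /\ (forall k, (k < r)%N -> (k * k * k < n)%N).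
Proof.
rewrite /cbrt_up; case: ex_minnP => m Hm Hmin; split=> // k km.
by rewrite ltnNge; apply/negP => /Hmin; rewrite leqNgt km.
Qed.

Lemma sqrt_up_gt0 : (0 < q)%N.
Proof. by have [H _] := sqrt_upP; clear - H n0; nia. Qed.

Lemma cbrt_up_gt0 : (0 < r)%N.
Proof. by have [H _] := cbrt_upP; clear - H n0; nia. Qed.

Lemma sqrt_up_le : (q <= n)%N.
Proof.
rewrite leqNgt; apply/negP => H; have [_ /(_ _ H)] := sqrt_upP; clear - n0; nia.
Qed.

Lemma cbrt_up_le_sqrt : (r <= q)%N.
Proof.
rewrite leqNgt; apply/negP => H; have [_ /(_ _ H)] := cbrt_upP.
by have [H2 _] := sqrt_upP; have := sqrt_up_gt0; clear - n0 H2; nia.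
Qed.

(** The square of [r * r] is at least [r ^ 3 >= n]. This ensures that there are at least [T]
    centers. *)
Lemma sqrt_up_le_sq : (q <= r * r)%N.
Proof.
rewrite leqNgt; apply/negP => H; have [_ /(_ _ H)] := sqrt_upP.
have [H2 _] := cbrt_upP; have := cbrt_up_gt0; clear - H2 => r0.
by have : (r * r * r <= r * r * (r * r))%N; [rewrite leq_mul2l; nia|lia].
Qed.

Lemma lt_pow_log : (n < X)%N.
Proof. exact: trunc_log_ltn. Qed.

Lemma pow_log_gt1 : (2 <= X)%N.
Proof. by rewrite expnS; have := expn_gt0 2 (trunc_log 2 n); lia. Qed.

Lemma log_lt_pow : (log_up n < X)%N.
Proof. exact: ltn_expl. Qed.

Lemma value_boundE : value_bound n = (X ^ 8)%N.
Proof. by rewrite /value_bound mulnC expnM. Qed.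

Lemma num_centers_lt : (num_centers n < X ^ 7)%N.
Proof.
rewrite /num_centers /log_factor.
have rX : (r < X)%N.
  by apply: leq_ltn_trans lt_pow_log; apply: leq_trans cbrt_up_le_sqrt sqrt_up_le.
have H16 : (16 <= X ^ 4)%N by rewrite (_ : 16 = 2 ^ 4)%N // leq_exp2r // pow_log_gt1.
have E : (X ^ 7 = X * X * (X ^ 4 * X))%N by rewrite mulnn -expnSr -expnD.
rewrite E; apply: (@leq_ltn_trans (X * X * (16 * log_up n))).
  by rewrite leq_mul // leq_mul // ltnW.
rewrite ltn_pmul2l; last by rewrite muln_gt0 !expn_gt0.
apply: (@leq_ltn_trans (X ^ 4 * log_up n)); first by rewrite leq_mul2r H16 orbT.
by rewrite ltn_pmul2l ?log_lt_pow // expn_gt0 expn_gt0.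
Qed.

Lemma value_bound_ge16 : (16 <= value_bound n)%N.
Proof.
by rewrite /value_bound (_ : 16 = 2 ^ 4)%N // leq_exp2l // /log_up; lia.
Qed.

Lemma value_bound_word : (value_bound n ^ 64 < 2 ^ word_size 1000 n)%N.
Proof.
rewrite /value_bound -expnM ltn_exp2l // /word_size -/(log_up n).
by rewrite mulnAC ltn_pmul2r.
Qed.

Lemma num_centers_value : (num_centers n < value_bound n)%N.
Proof.
rewrite value_boundE; apply: leq_trans num_centers_lt _.
by rewrite leq_exp2l // pow_log_gt1.
Qed.

Lemma sq_value : (n * n + n < value_bound n)%N.
Proof.
have H := lt_pow_log; rewrite value_boundE.
apply: (@leq_trans (X ^ 2)); first by rewrite -mulnn; nia.
by rewrite leq_exp2l // pow_log_gt1.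
Qed.

Lemma num_samples_le : (num_samples n <= num_centers n)%N.
Proof. by rewrite leq_mul2r sqrt_up_le_sq orbT. Qed.

Lemma sqrt_up_le_samples : (q <= num_samples n)%N.
Proof. by rewrite leq_pmulr. Qed.

End Sizes.

(** * Computing the parameters *)

Section Setup.
Variables (R : realType) (w a n : nat) (G : input n) (Y : nat).
Hypotheses (Y16 : (16 <= Y)%N) (YW : (Y ^ 64 < 2 ^ w)%N) (nY : (n <= Y)%N).

Lemma dtriple_while (I : nat -> state -> Prop) N tb e c s (Q : state -> Prop) :
  fits e ->
  (forall k s, small Y s -> I k s -> evaln s e != 0%N ->
    (k < N)%N /\ dtriple R w a G Y tb c s (I k.+1)) ->
  (forall k s, small Y s -> I k s -> evaln s e = 0%N -> Q s) ->
  I 0%N s -> dtriple R w a G Y (1 + N * (tb + 1)) (While e c) s Q.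
Proof.
move=> F Hc He I0 x.
apply: (@triple_while _ _ _ _ _ _ Y16 YW nY I (fun _ _ => x)) => //.
  by move=> k s0 ss Ik /(Hc _ _ ss Ik)[? H].
by move=> k s0 ss Ik /(He _ _ ss Ik).
Qed.

(** Linear search for the least solution of [p], shared by the square root and the cube root; it is
    cheap enough, as both are at most [sqrt_up n]. *)
Lemma search_spec (i : nat) e (p : pred nat) N s : fits e -> reg s i = 0%N ->
  (forall s', (forall j, j != i -> reg s' j = reg s j) ->
     evaln s' e = ~~ p (reg s' i) :> nat) ->
  p N -> (forall k, (k < N)%N -> ~~ p k) -> (N <= Y)%N ->
  dtriple R w a G Y (1 + N * 2)
    (While e (Assign i (Bop Add (Reg i) (Cst 1)))) s
    (fun s' => [/\ reg s' i = N, forall j, j != i -> reg s' j = reg s j &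
                   ram s' = ram s]).
Proof.
move=> F r0 He pN pk NY.
pose I k s1 := [/\ reg s1 i = k, (k <= N)%N,
  forall j, j != i -> reg s1 j = reg s j & ram s1 = ram s].
apply: (@dtriple_while I _ 1%N) => //.
- move=> k s1 _ [r1 kN fr rm]; rewrite He // r1 => H.
  have {}kN : (k < N)%N.
    by rewrite ltn_neqAle kN andbT; apply: contraNneq H => ->; rewrite pN.
  split=> //; apply: dtriple_assign => //=; rewrite r1 addn1; first exact: leq_trans NY.
  split=> //=; first by rewrite eqxx.
  by move=> j ji; rewrite (negPf ji) fr.
- move=> k s1 _ [r1 kN fr rm]; rewrite He // r1 => H.
  suff kE : k = N by split=> //; rewrite -kE.
  apply/eqP; rewrite eqn_leq kN leqNgt; apply/negP => /pk pk'.
  by move: H; rewrite pk'.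
Qed.

Hypotheses (n0 : (0 < n)%N) (Yn : (value_bound n <= Y)%N).

Lemma setup_spec :
  dtriple R w a G Y (30 + 4 * sqrt_up n + 4 * log_up n) setup
    (State (upd zeros 0 n) zeros)
    (fun s => params n (sqrt_up n) (num_centers n) (num_samples n) s /\
              centers_inv n (num_centers n) 0 (ram s)).
Proof.
have qY : (sqrt_up n <= Y)%N by apply: leq_trans nY; exact: sqrt_up_le.
have rY : (cbrt_up n <= Y)%N by apply: leq_trans qY; exact: cbrt_up_le_sqrt.
have MY : (num_centers n <= Y)%N.
  by apply: leq_trans Yn; apply/ltnW; exact: num_centers_value.
have TY : (num_samples n <= Y)%N by apply: leq_trans MY; exact: num_samples_le.
have XY k : (k <= log_up n)%N -> (2 ^ k <= Y)%N.
  move=> kl; apply: leq_trans Yn; rewrite leq_exp2l //; lia.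
have lY k : (k <= log_up n)%N -> (k <= Y)%N.
  by move=> kl; apply: leq_trans (XY _ kl); apply/ltnW; exact: ltn_expl.
apply: (@dtriple_mono _ _ _ _ _ _ ((1 + sqrt_up n * 2) + ((1 + cbrt_up n * 2) +
  (1 + ((1 + log_up n * 4) + (1 + (1 + (1 + 1).+1).+1).+1).+1).+1).+1).+1);
  [|have := cbrt_up_le_sqrt n0; lia|by move=> s _; exact].
apply: dtriple_seq; set s0 := State _ _.
have pq := sqrt_upP n; have pr := cbrt_upP n.
apply: (dtriple_mono (search_spec (p := fun k => (n <= k * k)%N) (N := sqrt_up n)
  _ _ _ _ _ _) (leqnn _)) => //=.
- by move=> s' /(_ 0%N isT) /= ->; rewrite ltnNge.
- by case: pq.
- by move=> k kq; rewrite -ltnNge; case: pq => _ ->.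
move=> s1 _ [q1 fr1 m1]; apply: dtriple_seq.
apply: (dtriple_mono (search_spec (p := fun k => (n <= k * k * k)%N) (N := cbrt_up n)
  _ _ _ _ _ _) (leqnn _)) => //=.
- by rewrite fr1.
- by move=> s' /(_ 0%N isT) /= ->; rewrite fr1 //= ltnNge.
- by case: pr.
- by move=> k kq; rewrite -ltnNge; case: pr => _ ->.
move=> s2 _ [r2 fr2 m2]; apply: dtriple_seq; apply: dtriple_assign => //=.
  exact: leq_trans Y16.
apply: dtriple_seq.
pose I k s := [/\ [/\ reg s 0 = n, reg s 1 = sqrt_up n & reg s 2 = cbrt_up n],
  (k <= log_up n)%N, reg s 3 = (2 ^ k)%N, reg s 4 = k & ram s = zeros].
have kl k : (2 ^ k <= n)%N -> (k < log_up n)%N.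
  by move=> kn; rewrite /log_up ltnS; exact: trunc_log_max.
apply: (@dtriple_while I _ 3%N) => //=.
- move=> k s [] _ _ [[R0 R1 R2] kN R3 R4 mz]; rewrite R3 R0 addn1 ltnS => H.
  have {}H : (2 ^ k <= n)%N by move: H; case: leqP.
  have kl' := kl _ H.
  split=> //; apply: (@dtriple_seq _ _ _ _ _ _ 1 1).
  apply: dtriple_assign => //=; rewrite R3 -expnSr; first exact: XY.
  apply: dtriple_assign => //=; rewrite R4 addn1; first exact: lY.
  by [].
- move=> k s3 _ [[R0 R1 R2] kN R3 R4 mz]; rewrite R3 R0 addn1 ltnS => H.
  have {}H : k = log_up n.
    apply/eqP; rewrite eqn_leq kN /= /log_up.
    have nk : (n < 2 ^ k)%N by move: H; case: leqP.
    by rewrite -(@ltn_exp2l 2) //; apply: leq_ltn_trans nk; exact: trunc_logP.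
  rewrite {}H in R3 R4.
  apply: dtriple_seq; apply: dtriple_assign => //=; rewrite R4 -/(log_factor n).
    apply: leq_trans TY; rewrite /num_samples.
    by rewrite leq_pmull // sqrt_up_gt0.
  apply: dtriple_seq; apply: dtriple_assign => //=; rewrite R2 -/(num_centers n) //.
  apply: dtriple_seq; apply: dtriple_assign => //=; rewrite R1 -/(num_samples n) //.
  apply: dtriple_store => //=; split=> //; rewrite mz.
  have Z i : (i %% 4 != 0)%N -> upd zeros 0 (num_centers n) i = 0%N.
    by move=> Hi; rewrite /= ifF //; apply: contraNF Hi => /eqP ->.
  have K x : (key_at x %% 4 != 0)%N by rewrite /key_at; lia.
  split; [split=> [//|i|x|i]|split=> x].
  - by lia.
  - by rewrite Z.
  - by lia.
  - by rewrite Z.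
  - by rewrite Z // /cluster_at; lia.
  - by rewrite Z //; lia.
- by rewrite /I /= (fr2 0%N) // (fr2 1%N) // (fr2 4%N) // r2 (fr1 0%N) //
    (fr1 4%N) //= q1 m2 m1.
Qed.

End Setup.

(** * The spanner *)

Lemma dist_walk (R : realType) n (H : graph n) u p :
  path H u p -> (dist R H u (last u p) <= (size p)%:R%:E)%E.
Proof. by move=> Hp; apply: ereal_inf_lbound; exists p. Qed.

(** Replacing each edge of a walk in [G] by its detour multiplies the length by at most [t]. *)
Lemma spanner_of_edges (R : realType) t n (G H : graph n) :
  (0 < t)%N -> subrel H G ->
  (forall u v, G u v -> exists p,
     [/\ path H u p, last u p = v & (size p <= t)%N]) ->
  spanner R t G H.
Proof.
move=> t0 HG He; split=> // u v.
have walk p : path G u p ->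
    exists p', [/\ path H u p', last u p' = last u p & (size p' <= t * size p)%N].
  elim: p u => [|x p IH] u /=; first by exists [::].
  case/andP=> /He[p1 [Hp1 l1 s1]] /IH[p2 [Hp2 l2 s2]].
  exists (p1 ++ p2); rewrite cat_path last_cat l1 Hp1 size_cat mulnS.
  by split=> //; exact: leq_add.
have t0R : (0 < t%:R :> R) by rewrite ltr0n.
(* Moving [t] to the left leaves a bare infimum on the right, so the bound is checked walk by walk,
   vacuously if there is none. *)
rewrite muleC -lee_pdivrMr //; apply/ereal_infP => _ [p [Hp <-] <-].
rewrite lee_pdivrMr // -EFinM -natrM mulnC.
have [p' [Hp' <- sp]] := walk p Hp.
by apply: le_trans (dist_walk R Hp') _; rewrite lee_fin ler_nat.
Qed.

Definition keep_edge (n : nat) (m : nat -> nat) (u v : nat) : bool :=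
  let cu := m (cluster_at u) in
  let e := m (pair_at (m 0%N) cu (m (cluster_at v))) in
  [|| cu == 0%N, m (center_at cu) == v, e == 0%N | e == u * n + v + 1]%N.

Section OracleGraph.
Variables (n : nat) (G : input n) (m : nat -> nat).

Definition oracle_rel : rel 'I_n :=
  fun u v => G u v && (keep_edge n m u v || keep_edge n m v u).

Lemma oracle_rel_sym : symmetric oracle_rel.
Proof. by move=> u v; rewrite /oracle_rel adj_sym orbC. Qed.

Lemma oracle_rel_irr : irreflexive oracle_rel.
Proof. by move=> u; rewrite /oracle_rel adj_irr. Qed.

Definition oracle_graph : graph n := Graph oracle_rel_sym oracle_rel_irr.

Lemma query_spec (R : realType) (w a Y : nat) :
  (16 <= Y)%N -> (Y ^ 64 < 2 ^ w)%N -> (n <= Y)%N -> (forall i, m i <= Y)%N ->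
  adjacency_oracle w a G m query_cmd (a + 2) oracle_graph.
Proof.
move=> Y16 YW nY mY; split=> // u v; rewrite /query_start; set s := State _ _.
have ss : small Y s.
  split=> //= i; have := ltn_ord u; have := ltn_ord v.
  by case: eqP => _; [lia|case: eqP => _; [lia|case: eqP]].
suff H : dtriple R w a G Y (a + 2) query_cmd s
    (fun s' => reg s' 0 = oracle_graph u v :> nat).
  apply: (@run_halts R _ _ _ _ _ (fun=> 0) _ 0).
  rewrite -[(a + 2)%N]addn0; apply: (H 0 ss) => s' _ Qs'; exact: run_halt.
rewrite addn2 -addn1; apply: dtriple_seq; apply: dtriple_adjacent => //=.
apply: dtriple_assign => //=.
  by apply: leq_trans (leq_b1 _) _; exact: leq_trans Y16.
rewrite adj_test_ord /oracle_rel /keep_edge -/(cluster_at u) -/(cluster_at v).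
rewrite -![(4 * m _)%N]/(center_at _) -![(4 * _ + 3)%N]/(pair_at _ _ _).
case: (input_graph G u v) => //=.
case: (m (cluster_at u) == 0%N) => //=.
case: (m (center_at _) == v) => //=.
case: (m (pair_at _ _ _) == 0%N) => //=.
case: (m (pair_at _ _ _) == (u * n + v + 1)%N) => //=.
case: (m (cluster_at v) == 0%N) => //=.
case: (m (center_at _) == u) => //=.
case: (m (pair_at _ _ _) == 0%N) => //=.
by case: (m (pair_at _ _ _) == (v * n + u + 1)%N).
Qed.

Let adj := adj_test G.
Let c v := m (cluster_at v).
Let M := m 0%N.

Hypotheses (cM : forall v, (c v <= M)%N)
  (cadj : forall v, (0 < c v)%N -> adj (m (center_at (c v))) v)
  (pairs : forall i j, (i <= M)%N -> (j <= M)%N -> m (pair_at M i j) != 0%N ->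
        exists u x, [/\ adj u x, c u = i, c x = j &
                        m (pair_at M i j) = (u * n + x + 1)%N]).

Lemma oracle_center (u s : 'I_n) : (0 < c u)%N -> val s = m (center_at (c u)) ->
  oracle_rel u s.
Proof.
move=> cu sE; rewrite /oracle_rel /keep_edge -/(c u) -sE eqxx orbT andbT.
by rewrite -adj_test_ord adj_test_sym [in adj_test _ _ _]/= sE; exact: cadj.
Qed.

Lemma oracle_spanner (R : realType) : spanner R 5 G oracle_graph.
Proof.
apply: spanner_of_edges => // [u v /andP[]//|u v Guv].
have [Huv|] := boolP (oracle_rel u v).
  by exists [:: v]; rewrite /= Huv.
rewrite /oracle_rel Guv /= negb_or /keep_edge !negb_or -/(c u) -/(c v) -/M.
case/andP => /and4P[cu _ nz _] /and4P[cv _ _ _].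
have [x [y [xy cx cy exy]]] := pairs (cM u) (cM v) nz.
rewrite -lt0n in cu; rewrite -lt0n in cv.
pose su := Ordinal (adj_test_ltl (cadj cu)).
pose sv := Ordinal (adj_test_ltl (cadj cv)).
pose xo := Ordinal (adj_test_ltl xy); pose yo := Ordinal (adj_test_ltr xy).
(* Since [c x = c u] and [c y = c v], the four outer edges join vertices to their own centers; the
   middle edge is kept because it matches its own code. *)
exists [:: su; xo; yo; sv; v]; split=> //=; rewrite andbT.
have -> : oracle_rel u su by exact: oracle_center.
have -> : oracle_rel su xo.
  by rewrite oracle_rel_sym; apply: oracle_center; rewrite /= ?cx.
have -> : oracle_rel yo sv by apply: oracle_center; rewrite /= ?cy.
have -> : oracle_rel sv v by rewrite oracle_rel_sym; exact: oracle_center.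
have Gxy : G xo yo by rewrite -adj_test_ord; exact: xy.
rewrite !andbT /= /oracle_rel Gxy /=.
by rewrite /keep_edge -/(c x) -/(c y) -/M cx cy exy eqxx !orbT.
Qed.

(** * Number of edges of the oracle graph *)

Variables (q r l : nat).
Let L := (16 * l)%N.
Let T := (q * L)%N.
Let deg u := size (nbr_list G u).

Definition cluster_edges (i j : nat) : nat :=
  \sum_(u < n) \sum_(v < n) [&& adj u v, c u == i & c v == j].

Hypotheses (l0 : (0 < l)%N) (r0 : (0 < r)%N) (q0 : (0 < q)%N)
  (nq : (n <= q * q)%N)
  (nr : (n <= r * r * r)%N) (qr : (q <= r * r)%N)
  (ME : M = (r * r * L)%N) (Ml : (M < 2 ^ (7 * l))%N)
  (good : forall v, (v < n)%N -> (deg v * (M - c v) <= L * n)%N)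
  (found : forall i j, (0 < i <= M)%N -> (0 < j <= M)%N ->
     (2 * L * n * L <= cluster_edges i j * T * (M - i + 1))%N ->
     m (pair_at M i j) != 0%N).

Lemma card_pairs (P : rel 'I_n) :
  #|[set x : 'I_n * 'I_n | P x.1 x.2]%SET| = (\sum_(u < n) \sum_(v < n) P u v)%N.
Proof.
rewrite -sum1_card big_mkcond /= pair_bigA /=; apply: eq_bigr => x _.
by rewrite inE; case: (P _ _).
Qed.

(** A harmonic sum by dyadic blocks: the [2 ^ k] terms from [2 ^ k] on are each at most
    [C %/ 2 ^ k]. *)
Lemma sum_divn_pow2 C k : (\sum_(1 <= i < 2 ^ k) C %/ i <= k * C)%N.
Proof.
elim: k => [|k IH]; first by rewrite big_geq.
have k0 : (0 < 2 ^ k)%N by rewrite expn_gt0.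
rewrite (@big_cat_nat _ _ _ (2 ^ k)%N) //=; last by rewrite leq_exp2l.
rewrite mulSn addnC leq_add //.
apply: (@leq_trans (\sum_(2 ^ k <= i < 2 ^ k.+1) C %/ 2 ^ k)).
  rewrite !big_nat; apply: leq_sum => i /andP[ki _].
  exact: leq_div2l.
rewrite sum_nat_const_nat expnS mul2n -addnn addnK mulnC; exact: leq_trunc_div.
Qed.

(** For [c u = 0], [good] reads [deg u * (r * r * L) <= L * n], and [n <= r * r * r]. *)
Lemma unclustered_deg u : (u < n)%N -> c u = 0%N -> (deg u <= r)%N.
Proof.
move=> un cu; have := good un; rewrite cu subn0 ME.
have L0 : (0 < L)%N by rewrite muln_gt0.
rewrite mulnA mulnC leq_pmul2l // => H.
have : (deg u * (r * r) <= r * (r * r))%N.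
  by apply: leq_trans H _; apply: leq_trans nr _; rewrite mulnC.
by rewrite leq_pmul2r // muln_gt0 r0.
Qed.

(** Contrapositive of [found], simplified with [T = q * L] and [n <= q * q]. *)
Lemma unfound_cluster_edges i j : (0 < i <= M)%N -> (0 < j <= M)%N ->
  m (pair_at M i j) = 0%N ->
  (cluster_edges i j <= (2 * L * q) %/ (M - i + 1))%N.
Proof.
move=> iM jM z; have := found iM jM; rewrite z eqxx leqNgt.
case: ltnP => [H _|_ /(_ isT)//].
have L0 : (0 < L)%N by rewrite muln_gt0.
rewrite leq_divRL ?addn1 // -addn1; set E := cluster_edges i j in H *.
set k := (M - i + 1)%N in H *.
rewrite -(@leq_pmul2r (q * L)) ?muln_gt0 ?q0 //.
apply: (@leq_trans (2 * L * n * L)).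
  by apply/ltnW; apply: leq_ltn_trans H; rewrite /T mulnAC.
rewrite mulnA leq_pmul2r // -!mulnA !leq_mul2l; apply/orP; right.
by rewrite nq orbT.
Qed.

(** Edges are grouped by their pair of clusters. The bound does not depend on [j], whence the factor
    [M.+1]; over [i] it sums harmonically, with [M < 2 ^ (7 * l)]. *)
Lemma card_pairs_unfound :
  (#|[set x : 'I_n * 'I_n | [&& G x.1 x.2, 0 < c x.1, 0 < c x.2 &
        m (pair_at M (c x.1) (c x.2)) == 0]]%SET|
   <= M.+1 * (7 * l * (2 * L * q)))%N.
Proof.
rewrite -sum1_card.
pose f (x : 'I_n * 'I_n) : 'I_M.+1 * 'I_M.+1 := (inord (c x.1), inord (c x.2)).
rewrite (partition_big f xpredT) //=.
apply: (@leq_trans (\sum_(p : 'I_M.+1 * 'I_M.+1 )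
   if (0 < p.1)%N then (2 * L * q) %/ (M - p.1 + 1) else 0))%N.
  apply: leq_sum => -[i j] _.
  have fE (x : 'I_n * 'I_n) : f x == (i, j) -> c x.1 = i /\ c x.2 = j.
    by case/eqP=> <- <-; rewrite !inordK // ltnS; exact: cM.
  case: (boolP [&& 0 < i, 0 < j & m (pair_at M i j) == 0]%N); last first.
    move=> N; rewrite big1 // => x; rewrite inE => /andP[/and4P[_ c1 c2 z] /fE[E1 E2]].
    by move: N; rewrite -E1 -E2 c1 c2 z.
  case/and3P=> i0 j0 /eqP z /=; rewrite i0.
  apply: leq_trans (unfound_cluster_edges _ _ z).
  - rewrite /cluster_edges pair_bigA /= big_mkcond; apply: leq_sum => x _.
    case: ifP => //; rewrite inE => /andP[/and4P[Gx _ _ _] /fE[-> ->]].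
    by rewrite !eqxx /adj adj_test_ord Gx.
  - by rewrite i0 -ltnS ltn_ord.
  - by rewrite j0 -ltnS ltn_ord.
rewrite -(pair_bigA _ (fun (i j : 'I_M.+1) =>
   if (0 < i)%N then (2 * L * q) %/ (M - i + 1) else 0))%N /=.
under eq_bigr do rewrite sum_nat_const card_ord.
rewrite -big_distrr /= leq_mul2l; apply/orP; right.
rewrite big_ord_recl /= add0n.
apply: leq_trans (sum_divn_pow2 _ _).
apply: (@leq_trans (\sum_(1 <= i < M.+1) (2 * L * q) %/ i))%N.
  rewrite big_add1 /= big_mkord (reindex_inj rev_ord_inj) /=.
  by apply: leq_sum => i _; rewrite leq_div2l // /bump /=; have := ltn_ord i; lia.
rewrite [leqRHS](@big_cat_nat _ _ _ M.+1) //=; exact: leq_addr.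
Qed.

(** A slot holds a single code, and a code determines its edge by its digits in base [n]; so sending
    an edge to its pair of clusters is injective here. *)
Lemma card_pairs_coded :
  (#|[set x : 'I_n * 'I_n |
        (m (pair_at M (c x.1) (c x.2)) == x.1 * n + x.2 + 1)%N]%SET|
   <= M.+1 * M.+1)%N.
Proof.
pose f (x : 'I_n * 'I_n) : 'I_M.+1 * 'I_M.+1 := (inord (c x.1), inord (c x.2)).
rewrite -[X in (_ <= X * X)%N]card_ord -card_prod -(@card_in_imset _ _ f).
  exact: max_card.
move=> [u v] [u' v']; rewrite !inE /= => /eqP E1 /eqP E2 [] /(congr1 val) /= F1.
move=> /(congr1 val) /= F2; move: F1 F2.
rewrite !inordK ?ltnS ?cM // => F1 F2; move: E2; rewrite -F1 -F2 E1 => /eqP.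
rewrite eqn_add2r => /eqP E.
have n0 : (0 < n)%N by apply: leq_ltn_trans (ltn_ord u).
have := congr1 (divn^~ n) E; have := congr1 (modn^~ n) E.
rewrite /= !modnMDl !divnMDl // !divn_small // !modn_small // !addn0.
by move=> /val_inj -> /val_inj ->.
Qed.

Lemma card_oracle_edges : (#|edges oracle_graph| <= 8 * r ^ 4 * L ^ 3)%N.
Proof.
(* These sets follow the cases of [keep_edge]; an unclustered second end is set apart as [K2], so
   that [K4] concerns only nonzero clusters. *)
pose K1 := [set x : 'I_n * 'I_n | adj x.1 x.2 && (c x.1 == 0)%N]%SET.
pose K2 := [set x : 'I_n * 'I_n | adj x.1 x.2 && (c x.2 == 0)%N]%SET.
pose K3 := [set x : 'I_n * 'I_n | m (center_at (c x.1)) == x.2]%SET.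
pose K4 := [set x : 'I_n * 'I_n | [&& G x.1 x.2, 0 < c x.1, 0 < c x.2 &
        m (pair_at M (c x.1) (c x.2)) == 0]%N]%SET.
pose K5 := [set x : 'I_n * 'I_n |
        (m (pair_at M (c x.1) (c x.2)) == x.1 * n + x.2 + 1)%N]%SET.
have d_le (u : 'I_n) : c u = 0%N -> (\sum_(v < n) adj u v <= r)%N.
  by move=> cu; rewrite -size_nbr_list; exact: unclustered_deg.
have k1 : (#|K1| <= n * r)%N.
  rewrite (card_pairs (fun u v => adj u v && (c u == 0)%N)).
  rewrite -[X in (_ <= X * _)%N]card_ord -sum_nat_const; apply: leq_sum => u _.
  case: (c u =P 0%N) => cu; last by rewrite big1 // => v _; rewrite andbF.
  by under eq_bigr do rewrite andbT; exact: d_le.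
have k2 : (#|K2| <= n * r)%N.
  rewrite (card_pairs (fun u v => adj u v && (c v == 0)%N)) exchange_big /=.
  rewrite -[X in (_ <= X * _)%N]card_ord -sum_nat_const; apply: leq_sum => u _.
  case: (c u =P 0%N) => cu; last by rewrite big1 // => v _; rewrite andbF.
  under eq_bigr do rewrite andbT /adj adj_test_sym; exact: d_le.
have k3 : (#|K3| <= n)%N.
  rewrite -[X in (_ <= X)%N]card_ord -(@card_in_imset _ _ fst); first exact: max_card.
  move=> [u v] [u' v']; rewrite !inE /= => /eqP E1 /eqP E2 E; move: E2.
  by rewrite -E E1 => /val_inj ->.
have k4 := card_pairs_unfound; rewrite -/K4 in k4.
have k5 := card_pairs_coded; rewrite -/K5 in k5.
pose f (x : 'I_n * 'I_n) := [set x.1; x.2]%SET.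
pose K := (K1 :|: (K2 :|: (K3 :|: (K4 :|: K5))))%SET.
have sub : edges oracle_graph \subset f @: K.
  have inK (u v : 'I_n) : G u v -> keep_edge n m u v -> (u, v) \in K.
    move=> Guv; rewrite /keep_edge -/(c u) -/(c v) -/M !inE /= Guv.
    rewrite /adj adj_test_ord Guv /=.
    rewrite !lt0n; case: (c u == 0%N) => //=; case: (c v == 0%N) => //=.
  apply/fintype.subsetP => A /imsetP[[u v]]; rewrite inE /= => /andP[Guv] /orP[k|k] ->.
    by apply/imsetP; exists (u, v) => //; exact: inK.
  apply/imsetP; exists (v, u); first by apply: inK => //; rewrite adj_sym.
  by rewrite /f /= finset.setUC.
apply: leq_trans (subset_leq_card sub) _.
apply: leq_trans (leq_imset_card _ _) _.
have cU (A B : {set 'I_n * 'I_n}) x y :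
    (#|A| <= x -> #|B| <= y -> #|A :|: B| <= x + y)%N.
  by move=> Ax By; apply: leq_trans (leq_card_setU _ _) _; exact: leq_add.
apply: (leq_trans (cU _ _ _ _ k1 (cU _ _ _ _ k2 (cU _ _ _ _ k3 (cU _ _ _ _ k4 k5))))).
(* All five bounds are compared with [r ^ 4 * L ^ 3]; [16 <= L] absorbs the lower powers of [L]. *)
have L16 : (16 <= L)%N by rewrite /L; lia.
have r4 : (r ^ 4 = r * r * (r * r))%N by rewrite !expnS expn0 muln1 !mulnA.
have M1 : (M.+1 <= 2 * (r * r * L))%N.
  by rewrite -ME mul2n -addnn -addn1 leq_add2l ME /L !muln_gt0 r0 l0.
have b1 : (n * r <= r ^ 4)%N by rewrite r4 mulnA leq_mul2r nr orbT.
have b3 : (n <= r ^ 4)%N.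
  by apply: leq_trans b1; rewrite leq_pmulr.
have b4 : (M.+1 * (7 * l * (2 * L * q)) <= 2 * (r ^ 4 * L ^ 3))%N.
  apply: (@leq_trans (2 * (r * r * L) * (L * (L * (r * r))))).
    apply: leq_mul => //; rewrite -[(2 * L * q)%N]mulnA mulnA.
    by apply: leq_mul; [rewrite /L; lia|rewrite leq_mul2l qr orbT].
  by rewrite r4 !expnS expn0 muln1; apply: eq_leq; ring.
have b5 : (M.+1 * M.+1 <= 4 * (r ^ 4 * L ^ 2))%N.
  apply: leq_trans (leq_mul M1 M1) _.
  by rewrite r4 !expnS expn0 muln1; apply: eq_leq; ring.
have b6 : (r ^ 4 * L ^ 2 * 16 <= r ^ 4 * L ^ 3)%N.
  by rewrite -mulnA leq_mul2l [(L ^ 3)%N]expnSr leq_mul2l L16 !orbT.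
have b7 : (r ^ 4 <= r ^ 4 * L ^ 2)%N.
  by rewrite leq_pmulr // expn_gt0 /L muln_gt0 l0.
by rewrite -mulnA; lia.
Qed.

End OracleGraph.

(** * Failure probability *)

Lemma expRN_natr_le (R : realType) (k : nat) : expR (- k%:R) <= (2 ^+ k)^-1 :> R.
Proof.
rewrite expRN -(mulr1 k%:R) expRM_natl lef_pV2 ?posrE ?exprn_gt0 ?expR_gt0 //.
by rewrite lerXn2r ?nnegrE ?expR_ge0 // -[leLHS]/(1 + 1 : R) expR_ge1Dx.
Qed.

(** From [1 - x <= 1 - y <= expR (- y)]. *)
Lemma ler_exprn_expR (R : realType) (x y z : R) k : 0 <= 1 - x ->
  z <= y * k%:R -> y <= x -> (1 - x) ^+ k <= expR (- z).
Proof.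
move=> x1 zy yx; apply: (@le_trans _ _ (expR (- y) ^+ k)).
  rewrite lerXn2r ?nnegrE ?expR_ge0 //.
  by apply: le_trans (expR_ge1Dx _); rewrite lerD2l lerN2.
by rewrite -expRM_natl ler_expR mulrN lerN2 mulrC.
Qed.

Lemma sum_indicator_ge1 (R : realType) (J : finType) (P b : pred J) p :
  P p -> b p -> 1 <= \sum_(x | P x) (b x)%:R :> R.
Proof.
move=> Pp bp; rewrite (bigD1 p) //= bp lerDl.
by apply: sumr_ge0 => x _; rewrite ler0n.
Qed.

Lemma nonadj_rate_expR (R : realType) n (G : input n) L v t : (0 < n)%N ->
  (L * n <= size (nbr_list G v) * t)%N ->
  nonadj_rate R G v ^+ t <= expR (- L%:R).
Proof.
move=> n0 H; have nR : 0 < n%:R :> R by rewrite ltr0n.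
apply: (@ler_exprn_expR _ _ ((size (nbr_list G v))%:R / n%:R)) => //.
  exact: nonadj_rate_ge0.
by rewrite mulrAC ler_pdivlMr // -!natrM ler_nat.
Qed.

Section ClusterPairs.
Variables (R : realType) (n : nat) (G : input n) (M L T : nat) (m : nat -> nat).
Let deg u := size (nbr_list G u).
Let c v := m (cluster_at v).
Hypotheses (n0 : (0 < n)%N) (L0 : (0 < L)%N)
  (cdeg : forall u, (0 < c u)%N -> (0 < deg u)%N)
  (good : forall v, (v < n)%N -> (deg v * (M - c v) <= L * n)%N).

Lemma cluster_edges_hits i j :
  cluster_edges G m i j = (\sum_(u < n) if c u == i then hits G m u j else 0)%N.
Proof.
apply: eq_bigr => u _; rewrite -/(c u); case: eqP => cu; last first.
  by rewrite big1 // => v _; rewrite andbF.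
rewrite /hits -size_filter.
rewrite -(big_mkord xpredT (fun x =>
  [&& adj_test G u x, true & m (cluster_at x) == j] : nat)).
rewrite (eq_bigr (fun x =>
  if adj_test G u x && (m (cluster_at x) == j) then 1%N else 0%N)); last first.
  by move=> x _ /=; case: (adj_test G u x); case: (_ == j).
rewrite -big_mkcond sum1_count /index_iota subn0 -size_filter; apply: perm_size.
apply: uniq_perm; rewrite ?filter_uniq ?iota_uniq ?nbr_list_uniq // => x.
rewrite !mem_filter mem_iota mem_nbr_list add0n /=.
by case H: (adj_test G u x); rewrite ?andbF // (adj_test_ltr H) andbT.
Qed.

(** In cluster [p.1], [good] gives [deg u * k <= 2 * L * n], so a sample hits with probability at
    least [x u]. Over all samples the exponents add up to the number of edges times
    [T * k / (2 * L * n)], which is at least [L]. *)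
Lemma miss_rem_expR (p : 'I_M.+1 * 'I_M.+1) : (0 < p.1)%N ->
  (2 * L * n * L <= cluster_edges G m p.1 p.2 * T * (M - p.1 + 1))%N ->
  miss_rem R G T m 0 p <= expR (- L%:R).
Proof.
move=> p0 H; pose k := (M - p.1 + 1)%N.
have D0 : (0 : R) < (2 * L * n)%:R by rewrite ltr0n !muln_gt0 L0 n0.
pose x u : R := (if c u == p.1 then hits G m u p.2 else 0%N)%:R
  * (k%:R / (2 * L * n)%:R).
apply: (@le_trans _ _ (\prod_(u < n) expR (- (x u * T%:R)))).
  rewrite /miss_rem big_mkord; apply: ler_prod => u _.
  rewrite exprn_ge0 ?miss_rate_ge0 //= /miss_rate -/(c u) /x.
  case: eqP => cu; last by rewrite expr1n !mul0r oppr0 expR0.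
  have d0 : (0 < deg u)%N by apply: cdeg; rewrite cu.
  apply: (@ler_exprn_expR _ _ ((hits G m u p.2)%:R * (k%:R / (2 * L * n)%:R))) => //.
    have := miss_rate_ge0 R G m u p; rewrite /miss_rate -/(c u) cu eqxx; exact.
  rewrite ler_wpM2l // ler_pdivrMr // mulrC ler_pdivlMr ?ltr0n // -natrM ler_nat.
  have := good (ltn_ord u); rewrite cu => g.
  have dn : (deg u <= n)%N by exact: size_nbr_list_le.
  have Ln : (n <= L * n)%N by rewrite leq_pmull.
  (* The summand 1 of [k] costs [deg u <= n <= L * n], whence the factor 2. *)
  by rewrite /k mulnC mulnDr muln1 -mulnA mul2n -addnn leq_add // (leq_trans dn).
rewrite -expR_sum ler_expR sumrN lerN2 -mulr_suml -mulr_suml.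
rewrite -natr_sum -cluster_edges_hits mulrAC mulrA ler_pdivlMr //.
by rewrite -!natrM ler_nat; apply: leq_trans H; rewrite mulnC.
Qed.

End ClusterPairs.

(** * The construction *)

Definition size_bound (n : nat) : nat :=
  (8 * cbrt_up n ^ 4 * log_factor n ^ 3)%N.

Definition success (R : realType) (w a n : nat) (G : input n) (s : state) :
    Prop :=
  exists H : graph n,
    [/\ adjacency_oracle w a G (ram s) query_cmd (a + 2) H,
        spanner R 5 G H & (#|edges H| <= size_bound n)%N].

Section Build.
Variables (R : realType) (a n : nat) (G : input n).
Hypothesis n0 : (0 < n)%N.

Let w := word_size 1000 n.
Let Y := value_bound n.
Let q := sqrt_up n.
Let M := num_centers n.
Let T := num_samples n.
Let L := log_factor n.
Let deg u := size (nbr_list G u).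

Let Y16 : (16 <= Y)%N. Proof. exact: value_bound_ge16. Qed.
Let YW : (Y ^ 64 < 2 ^ w)%N. Proof. exact: value_bound_word. Qed.
Let nnY : (n * n + n < Y)%N. Proof. exact: sq_value. Qed.
Let nY : (n <= Y)%N. Proof. by apply: leq_trans (ltnW nnY); exact: leq_addl. Qed.
Let MY : (M < Y)%N. Proof. exact: num_centers_value. Qed.
Let TM : (T <= M)%N. Proof. exact: num_samples_le. Qed.
Let qT : (q <= T)%N. Proof. exact: sqrt_up_le_samples. Qed.
Let L0 : (0 < L)%N. Proof. by []. Qed.

(** The threshold at which [p.2] uniform centers all miss the neighborhood of [p.1] with probability
    at most [expR (- L)]. *)
Definition heavy (p : 'I_n * 'I_M.+1) : bool := (L * n <= deg p.1 * p.2)%N.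

Definition good_clusters (m : nat -> nat) : Prop :=
  forall v, (v < n)%N -> (deg v * (M - m (cluster_at v)) <= L * n)%N.

(** [good_clusters] is included because [miss_rem_expR] relies on it; if it fails, no pair is
    crowded and the failure is charged to [missed_sum]. *)
Definition crowded (m : nat -> nat) (p : 'I_M.+1 * 'I_M.+1) : bool :=
  [&& `[< good_clusters m >], (0 < p.1)%N, (0 < p.2)%N &
      (2 * L * n * L <= cluster_edges G m p.1 p.2 * T * (M - p.1 + 1))%N].

Lemma missed_of_bad (S m : nat -> nat) :
  (forall v, (v < n)%N ->
     cluster_ok G q M T (fun j => S (center_at j)) v (m (cluster_at v))) ->
  ~ good_clusters m -> 1 <= missed_sum R G heavy S.
Proof.
move=> ok /existsNP[v /not_implyP[vn /negP]]; rewrite -ltnNge => bad.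
have [cM _ nadj] := ok v vn; set c := m _ in bad cM nadj.
(* Only the last [T] centers are scanned when [deg v >= q], but then already
   these make [(v, T)] heavy. *)
pose t := minn (M - c) (if (deg v < q)%N then M else T).
have tM : (t < M.+1)%N by rewrite ltnS (leq_trans (geq_minl _ _)) ?leq_subr.
apply: (@sum_indicator_ge1 _ _ _ _ (Ordinal vn, Ordinal tM)).
  rewrite /heavy /= /t; case: ltnP => dq.
    by rewrite (minn_idPl (leq_subr _ _)) ltnW.
  rewrite /minn; case: ifP => _; first exact: ltnW.
  rewrite /T /num_samples -/q -/L mulnA [leqRHS]mulnC leq_mul2l; apply/orP; right.
  by have [nq _] := sqrt_upP n; apply: leq_trans nq _; rewrite leq_mul2r dq orbT.
apply/missedP => i /= /andP[i1 i2]; apply: nadj.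
  by rewrite i2 andbT; move: i1; rewrite /t; lia.
case: (ltnP (deg v) q) => dq; [by left|right].
by move: i1; rewrite /t (leq_gtF dq); have := TM; lia.
Qed.

(** A union bound within one run: bad clusters make the first sum at least 1, an empty crowded pair
    the second, and otherwise success is certain. [S], [m] and [ram s] are the memories after the
    centers, after the clusters and at the end. *)
Lemma success_or_fail S m s :
  (forall v, (v < n)%N ->
     cluster_ok G q M T (fun j => S (center_at j)) v (m (cluster_at v))) ->
  (forall v, (n <= v)%N -> m (cluster_at v) = 0%N) ->
  (forall i, (i %% 4 != 2)%N -> m i = S i) -> m 0%N = M ->
  small Y s -> pairs_inv G q M T m s ->
  1 - `[< success R w a G s >]%:R <=
    missed_sum R G heavy S +
    \sum_(p | crowded m p) (ram s (pair_at M p.1 p.2) == 0%N)%:R :> R.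
Proof.
move=> ok z mS m0 [_ sY] [Ps fr pr].
have ge1 : 0 <= missed_sum R G heavy S by apply: sumr_ge0 => p _; rewrite ler0n.
have ge2 : 0 <= \sum_(p | crowded m p) (ram s (pair_at M p.1 p.2) == 0%N)%:R :> R.
  by apply: sumr_ge0 => p _; rewrite ler0n.
have le1 : 1 - `[< success R w a G s >]%:R <= 1 :> R by rewrite gerBl ler0n.
have [good|bad] := pselect (good_clusters m); last first.
  by apply: le_trans le1 _; apply: le_trans (missed_of_bad ok bad) _; rewrite lerDl.
have [[p Pp zp]|nf] := pselect
  (exists2 p, crowded m p & ram s (pair_at M p.1 p.2) == 0%N).
  apply: le_trans le1 _; apply: le_trans (_ : _ <= 0 + _) (lerD ge1 (lexx _)).
  by rewrite add0r; exact: sum_indicator_ge1 Pp zp.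
suff H : success R w a G s by rewrite asboolT // subrr addr_ge0.
have c_s v : ram s (cluster_at v) = m (cluster_at v).
  by rewrite fr // /cluster_at; lia.
have s0 : ram s 0%N = M by rewrite fr.
have cM v : (ram s (cluster_at v) <= M)%N.
  rewrite c_s; case: (ltnP v n) => vn; last by rewrite z.
  by have [] := ok v vn.
exists (oracle_graph G (ram s)); split.
- exact: (query_spec G R a Y16 YW nY sY).
- apply: oracle_spanner; rewrite ?s0 //.
    move=> v; rewrite c_s; case: (ltnP v n) => vn; last by rewrite z.
    have [_ cadj _] := ok v vn => cv; rewrite fr; last by rewrite /center_at; lia.
    by rewrite mS; [exact: cadj|rewrite /center_at; lia].
  move=> i j iM jM nz; have [u [x [ux cu cx e]]] := pr i j iM jM nz.
  by exists u, x; rewrite !c_s.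
have [nq _] := sqrt_upP n; have [nr _] := cbrt_upP n.
have cE i j : cluster_edges G (ram s) i j = cluster_edges G m i j.
  by apply: eq_bigr => u _; apply: eq_bigr => v _; rewrite !c_s.
apply: (@card_oracle_edges _ _ _ _ q _ (log_up n)) => //; rewrite ?s0 //.
- exact: cbrt_up_gt0.
- exact: sqrt_up_gt0.
- exact: sqrt_up_le_sq.
- by rewrite mulnC expnM; exact: num_centers_lt.
- by move=> v vn; rewrite c_s; exact: good.
move=> i j /andP[i0 iM] /andP[j0 jM] H; apply/negP => zij; apply: nf.
exists (inord i, inord j); rewrite /= ?inordK ?ltnS //.
rewrite /crowded /= !inordK ?ltnS // i0 j0 -cE.
by apply/and4P; split=> //; exact/asboolP.
Qed.

(** At most [X ^ 15] events, each of probability at most [X ^ -16], with [n < X]. *)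
Lemma fail_prob_le :
  (M.+1 * M.+1)%:R * expR (- L%:R) + (n * M.+1)%:R * expR (- L%:R)
  <= 1 / n%:R :> R.
Proof.
rewrite -mulrDl -natrD.
set X := (2 ^ log_up n)%N.
have nX : (n < X)%N by exact: lt_pow_log.
have X2 : (2 <= X)%N by exact: pow_log_gt1.
have MX : (M.+1 <= X ^ 7)%N by exact: num_centers_lt.
apply: (@le_trans _ _ ((X ^ 15)%:R * (X ^ 16)%:R^-1)).
  apply: ler_pM; rewrite ?expR_ge0 //.
    rewrite ler_nat; apply: (@leq_trans (X ^ 14 + X ^ 14)).
      apply: leq_add; first by rewrite (expnD X 7 7) leq_mul.
      apply: leq_trans (leq_mul (ltnW nX) MX) _.
      by rewrite -expnS leq_exp2l.
    by rewrite addnn -mul2n (expnS X 14) leq_mul2r X2 orbT.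
  apply: le_trans (expRN_natr_le _ _) _.
  by rewrite /L /log_factor mulnC exprM -natrX -natrX.
have X0 : (X%:R : R) != 0 by rewrite pnatr_eq0 -lt0n; apply: ltnW.
rewrite (expnS X 15) natrM invfM mulrCA divff ?mulr1; last first.
  by rewrite natrX expf_neq0.
by rewrite div1r lef_pV2 ?posrE ?ltr0n ?ler_nat ?(ltnW nX) //; apply: ltnW.
Qed.

Lemma build_spec :
  run w a G (fun=> True) (fun s => 1 - `[< success R w a G s >]%:R : R)
    (8 * (n * T * (a + 8))) (1 / n%:R) (build_start n build_cmd).
Proof.
(* The share of the error reserved for the sampling phase while the centers are drawn. *)
pose eps : R := (M.+1 * M.+1)%:R * expR (- L%:R).
pose t1 := (30 + 4 * q + 4 * log_up n)%N.
pose t2 := (3 + M * 8)%N.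
pose t3 := (3 + n * (a + 8 + T * (a + 6)))%N.
pose t4 := (3 + n * (6 + T * (a + 6)))%N.
have HT : triple w a G Y (t1 + (t2 + (t3 + t4).+1).+1).+1 (1 / n%:R) build_cmd
    (State (upd zeros 0 n) zeros) (fun=> True)
    (fun s => 1 - `[< success R w a G s >]%:R : R).
  apply: (triple_seq (setup_spec Y16 YW nY n0 (leqnn _) (e := _))) => s1 _ [P1 C1].
  apply: triple_seq.
    apply: (triple_mono (draw_centers_spec Y16 YW nY n0 MY TM nnY
      (A := heavy) (eps := eps) P1 C1)
      (leqnn _) _ (fun s' _ H => conj H (lexx _))).
    apply: le_trans fail_prob_le; rewrite /eps lerD2l.
    apply: (@le_trans _ _ (\sum_(p : 'I_n * 'I_M.+1) expR (- L%:R))).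
      rewrite [leRHS](bigID heavy) /=.
      apply: (@le_trans _ _ (\sum_(p | heavy p) expR (- L%:R))).
        by apply: ler_sum => p hp; exact: nonadj_rate_expR.
      by rewrite lerDl; apply: sumr_ge0 => p _; exact: expR_ge0.
    by rewrite sumr_const card_prod !card_ord -[leLHS]mulr_natl.
  move=> s2 ss2 [P2 C2].
  apply: (triple_seq (form_clusters_spec Y16 YW nY n0 MY TM nnY qT P2 C2 (e := _))).
  move=> s3 ss3 [P3 fr ok z].
  have m0 : ram s3 0%N = M by rewrite fr //; case: C2 => -[].
  have [_ [_ cl0 pr0]] := C2.
  have pairs0 x : ram s3 (4 * x + 3)%N = 0%N by rewrite fr ?pr0 //; lia.
  have I3 : pairs_inv G q M T (ram s3) s3.
    by split=> // i j _ _; rewrite /pair_at pairs0 eqxx.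
  have cM v : (ram s3 (cluster_at v) <= M)%N.
    by case: (ltnP v n) => vn; [case: (ok v vn)|rewrite z].
  have cdeg v : (0 < ram s3 (cluster_at v))%N -> (0 < deg v)%N.
    case: (ltnP v n) => vn; last by rewrite z.
    have [_ H _] := ok v vn => /H; rewrite adj_test_sym -mem_nbr_list /deg.
    by case: nbr_list.
  have P0 p : crowded (ram s3) p -> (0 < p.1)%N /\ (0 < p.2)%N by case/and4P.
  (* The roles are exchanged: [missed_sum] is now fixed and set aside, and the reserved [eps] pays
     for the crowded pairs. *)
  apply: (triple_mono (sample_edges_spec Y16 YW nY MY TM nnY cM cdeg P0
    (eps := missed_sum R G heavy (ram s2)) I3) (leqnn _)).
    rewrite addrC lerD2r.
    apply: (@le_trans _ _ (\sum_(p : 'I_M.+1 * 'I_M.+1) expR (- L%:R))).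
      rewrite [leRHS](bigID (crowded (ram s3))) /=.
      apply: (@le_trans _ _ (\sum_(p | crowded (ram s3) p) expR (- L%:R))).
        apply: ler_sum => p /and4P[/asboolP good p1 _ H].
        exact: (miss_rem_expR R n0 L0 cdeg good p1 H).
      by rewrite lerDl; apply: sumr_ge0 => p _; exact: expR_ge0.
    by rewrite sumr_const card_prod !card_ord -[leLHS]mulr_natl.
  move=> s4 ss4 I4; split=> //; exact: success_or_fail ok z fr m0 ss4 I4.
have small0 : small Y (State (upd zeros 0 n) zeros).
  by split=> //= i; case: ifP.
apply: (run_mono (HT small0 (fun=> True) _ [::] 0%N _)) => //.
  by move=> s _ _; exact: run_halt.
have L16 : (16 <= L)%N by rewrite /L /log_factor /log_up; lia.
have T1 : (q * L = T)%N by [].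
have M1 : (M <= n * T)%N.
  rewrite /M /T /num_centers /num_samples mulnA leq_mul2r; apply/orP; right.
  by rewrite leq_mul // ?cbrt_up_le_sqrt //
    (leq_trans (cbrt_up_le_sqrt n0)) ?sqrt_up_le.
have q0 : (0 < q)%N by exact: sqrt_up_gt0.
have l1 : (log_up n <= L)%N by rewrite /L /log_factor; lia.
have LT : (L <= T)%N by rewrite -T1 leq_pmull.
have nT : (T <= n * T)%N by rewrite leq_pmull.
have nn : (n <= n * T)%N by rewrite leq_pmulr //; lia.
rewrite addn0 /t1 /t2 /t3 /t4; have qT' := qT.
have [N EN] : exists N, N = (n * T)%N by exists (n * T)%N.
rewrite -EN in nT nn M1 *.
have na : (n * a <= N * a)%N by rewrite leq_mul2r nn orbT.
have -> : (n * (a + 8 + T * (a + 6)) = n * a + n * 8 + N * a + N * 6)%N.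
  by rewrite EN; ring.
have -> : (n * (6 + T * (a + 6)) = n * 6 + N * a + N * 6)%N.
  by rewrite EN; ring.
have -> : (N * (a + 8) = N * a + N * 8)%N by ring.
by move: (N * a)%N (n * a)%N na => Na na' na; clear - L16 l1 LT nT nn M1 qT' na; lia.
Qed.

End Build.

(** * Asymptotics *)

Section Asymptotics.
Variable R : realType.

Lemma near_ln_ge1 : \forall n \near \oo, 1 <= ln n%:R :> R.
Proof.
near=> n; rewrite -[leLHS]expRK ler_ln ?posrE ?expR_gt0 //.
  by near: n; exact: nbhs_infty_ger.
by rewrite ltr0n; near: n; exact: nbhs_infty_gt.
Unshelve. all: by end_near. Qed.

Lemma ln_ge1_gt1 n : 1 <= ln n%:R :> R -> (1 < n)%N.
Proof.
case: n => [|[|n]] //; first by rewrite ln0 // ler10.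
by rewrite ln1 ler10.
Qed.

Lemma log_up_le_ln n : 1 <= ln n%:R :> R ->
  (log_up n)%:R <= ((ln 2)^-1 + 1) * ln n%:R :> R.
Proof.
move=> ln1; have n1 := ln_ge1_gt1 ln1.
have l2 : 0 < ln 2 :> R by rewrite ln_gt0 // ltr1n.
rewrite /log_up -addn1 natrD mulrDl mul1r lerD // mulrC ler_pdivlMr //.
rewrite mulr_natl -lnXn // ler_ln ?posrE ?exprn_gt0 ?ltr0n //; last exact: ltnW.
by rewrite -natrX ler_nat trunc_logP // ltnW.
Qed.

(** By minimality the square of [q - 1] is below [n], and [q <= 2 * (q - 1)]; hence the constant 4,
    and likewise 8 for the cube root. *)
Lemma sqrt_up_le_powR n : (1 < n)%N ->
  (sqrt_up n)%:R <= 4 `^ 2^-1 * n%:R `^ 2^-1 :> R.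
Proof.
move=> n1; have [H1 H2] := sqrt_upP n.
have q2 : (2 <= sqrt_up n)%N by move: H1 n1; clear; nia.
have H : (sqrt_up n ^ 2 <= 4 * n)%N.
  by have := H2 (sqrt_up n).-1; rewrite -mulnn; clear - q2; nia.
have -> : (sqrt_up n)%:R = ((sqrt_up n ^ 2)%:R : R) `^ 2^-1.
  by rewrite natrX -powR_mulrn // -powRrM divff // powRr1.
rewrite -powRM // -natrM; apply: ge0_ler_powR; rewrite ?nnegrE //.
by rewrite ler_nat.
Qed.

Lemma cbrt_up_le_powR n : (1 < n)%N ->
  (cbrt_up n ^ 4)%:R <= 8 `^ (4 / 3) * n%:R `^ (4 / 3) :> R.
Proof.
move=> n1; have [H1 H2] := cbrt_upP n.
have r2 : (2 <= cbrt_up n)%N by move: H1 n1; clear; nia.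
have H : (cbrt_up n ^ 3 <= 8 * n)%N.
  have := H2 (cbrt_up n).-1; rewrite prednK; last exact: ltnW.
  move=> /(_ (leqnn _)); case: (cbrt_up n) r2 => // k k1 /= Hk.
  have : (k.+1 ^ 3 <= (2 * k) ^ 3)%N by rewrite leq_exp2r; lia.
  by rewrite expnMn -[(2 ^ 3)%N]/8%N !expnS expn0 muln1 !mulnA; clear - Hk; lia.
have -> : (cbrt_up n ^ 4)%:R = ((cbrt_up n ^ 3)%:R : R) `^ (4 / 3).
  by rewrite !natrX -!powR_mulrn // -powRrM; congr (_ `^ _); field.
rewrite -powRM // -natrM; apply: ge0_ler_powR; rewrite ?nnegrE //.
by rewrite ler_nat.
Qed.

Lemma size_bound_softO :
  softO (fun n => (size_bound n)%:R : R) (fun n => n%:R `^ (4 / 3)).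
Proof.
exists (8 * 8 `^ (4 / 3) * 16 ^+ 3 * ((ln 2)^-1 + 1) ^+ 3), 3%N.
near=> n.
have ln1 : 1 <= ln n%:R :> R by near: n; exact: near_ln_ge1.
have n1 := ln_ge1_gt1 ln1.
rewrite ger0_norm // ger0_norm ?powR_ge0 // /size_bound /log_factor.
have -> : (8 * cbrt_up n ^ 4 * (16 * log_up n) ^ 3)%:R =
    8 * (cbrt_up n ^ 4)%:R * (16 ^+ 3 * (log_up n)%:R ^+ 3) :> R.
  by rewrite expnMn !natrM; ring.
have Hr := cbrt_up_le_powR n1; have Hl := log_up_le_ln ln1.
have {}Hl : (log_up n)%:R ^+ 3 <= (((ln 2)^-1 + 1) * ln n%:R) ^+ 3 :> R.
  by rewrite lerXn2r ?nnegrE // (le_trans _ Hl).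
apply: (@le_trans _ _ (8 * (8 `^ (4 / 3) * n%:R `^ (4 / 3)) *
   (16 ^+ 3 * (((ln 2)^-1 + 1) * ln n%:R) ^+ 3))).
  apply: ler_pM; rewrite ?mulr_ge0 ?exprn_ge0 //; first exact: ler_wpM2l.
  by apply: ler_wpM2l => //; exact: exprn_ge0.
by rewrite [leRHS](_ : _ = 8 * (8 `^ (4 / 3) * n%:R `^ (4 / 3)) *
   (16 ^+ 3 * (((ln 2)^-1 + 1) * ln n%:R) ^+ 3)) //; ring.
Unshelve. all: by end_near. Qed.

Lemma build_time_softO (access : nat -> nat) :
  softO (fun n => (access n)%:R : R) (fun=> 1) ->
  softO (fun n => (8 * (n * num_samples n * (access n + 8)))%:R : R)
        (fun n => n%:R `^ (3 / 2)).
Proof.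
move=> [C [k HC]].
(* One logarithm comes from [L], the other [k] from the access time. *)
exists (8 * 4 `^ 2^-1 * 16 * ((ln 2)^-1 + 1) * (C + 8)), k.+1.
near=> n.
have ln1 : 1 <= ln n%:R :> R by near: n; exact: near_ln_ge1.
have : `|(access n)%:R| <= C * `|1| * ln n%:R ^+ k :> R by near: n; exact: HC.
rewrite ger0_norm // normr1 mulr1 => Ha; have n1 := ln_ge1_gt1 ln1.
rewrite ger0_norm // ger0_norm ?powR_ge0 // /num_samples /log_factor.
have Hq := sqrt_up_le_powR n1; have Hl := log_up_le_ln ln1.
have -> : n%:R `^ (3 / 2) = n%:R * n%:R `^ 2^-1 :> R.
  rewrite -[X in _ = X * _]powRr1 // -powRD; last first.
    by apply/implyP => _; rewrite pnatr_eq0 -lt0n ltnW.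
  by congr (_ `^ _); field.
have {}Ha : (access n + 8)%:R <= (C + 8) * ln n%:R ^+ k :> R.
  rewrite natrD mulrDl lerD // ler_peMr // exprn_ege1 //.
have p0 : 0 <= n%:R `^ 2^-1 :> R by exact: powR_ge0.
rewrite !natrM.
apply: (@le_trans _ _ (8 * (n%:R * ((4 `^ 2^-1 * n%:R `^ 2^-1) *
  (16 * (((ln 2)^-1 + 1) * ln n%:R))) * ((C + 8) * ln n%:R ^+ k)))).
  apply: ler_wpM2l => //; apply: ler_pM => //.
  apply: ler_wpM2l => //; apply: ler_pM => //.
  exact: ler_wpM2l.
by rewrite [leRHS](_ : _ = (8 * (n%:R * ((4 `^ 2^-1 * n%:R `^ 2^-1) *
  (16 * (((ln 2)^-1 + 1) * ln n%:R))) * ((C + 8) * ln n%:R ^+ k)))) // exprS; ring.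
Unshelve. all: by end_near. Qed.

Lemma query_time_softO (access : nat -> nat) :
  softO (fun n => (access n)%:R : R) (fun=> 1) ->
  softO (fun n => (access n + 2)%:R : R) (fun=> 1).
Proof.
move=> [C [k HC]]; exists (C + 2), k; near=> n.
have ln1 : 1 <= ln n%:R :> R by near: n; exact: near_ln_ge1.
have : `|(access n)%:R| <= C * `|1| * ln n%:R ^+ k :> R by near: n; exact: HC.
rewrite normr1 !mulr1 !ger0_norm // => Ha.
by rewrite natrD mulrDl lerD // ler_peMr // exprn_ege1.
Unshelve. all: by end_near. Qed.

End Asymptotics.

Unset Implicit Arguments.

Theorem mainTheorem4 (R : realType) :
  exists (b : nat) (build query : cmd) (c : R) (size_bound : nat -> nat),
    [/\ 0 < c,
        softO (fun n => (size_bound n)%:R : R) (fun n => n%:R `^ (4 / 3)) &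
        forall access : nat -> nat,
          softO (fun n => (access n)%:R : R) (fun=> 1) ->
          exists build_time query_time : nat -> nat,
            [/\ softO (fun n => (build_time n)%:R : R)
                      (fun n => n%:R `^ (3 / 2)),
                softO (fun n => (query_time n)%:R : R) (fun=> 1) &
                forall (n : nat) (G : input n), (0 < n)%N ->
                  let w := word_size b n in
                  let a := access n in
                  halts_within w a G (fun=> True) (build_time n)
                    (build_start n build) /\
                  1 - 1 / n%:R `^ c <=
                    prob R w a G
                      (fun s => exists H : graph n,
                        [/\ adjacency_oracle w a G (ram s) query
                              (query_time n) H,
                            spanner R 5 G H &
                            (#|edges H| <= size_bound n)%N])
                      (build_start n build)]].
Proof.
(* The exponent 1 is that of the failure bound [1 / n]; 1000 is the word size parameter of
   [value_bound_word]. *)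
exists 1000%N, build_cmd, query_cmd, 1, size_bound.
split; [exact: ltr01|exact: size_bound_softO|].
move=> access Ha; exists (fun n => 8 * (n * num_samples n * (access n + 8)))%N.
exists (fun n => access n + 2)%N.
split; [exact: build_time_softO|exact: query_time_softO|].
move=> n G n0 w a; have H := build_spec R a G n0.
split; first exact: run_halts H.
rewrite powRr1 //; apply: run_prob H => s _.
by rewrite opprB addrC subrK.
Qed.
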